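(* Let $\mathcal{U}\subset \mathcal{C}_0$ be an open set such that $\lambda\,\mathcal{U}\subset\mathcal{U}$ for all $\lambda\in(0,1]$, let $\phi$ be defined on $J\times\mathcal{U}$ (satisfying the regularity assumptions of the context with $\mathcal{D}=\mathcal{U}$), and assume that the flow $M_\cdot^\cdot(\cdot)$ of $\dot x(t)=\phi(t,x(t))$ is order-preserving on $\mathcal{U}$. Then the best (i.e. greatest) constant $\alpha$ such that $$d_T(M_s^t(x_1),M_s^t(x_2))\leq e^{-\alpha(t-s)}\,d_T(x_1,x_2)\qquad\text{whenever } s\in J \text{ and } s\leq t<\min\{t_{\mathcal{U}}(s,x_1),t_{\mathcal{U}}(s,x_2)\}$$ holds for all $x_1,x_2\in\mathcal{U}$ is given by $$\alpha=-\sup_{s\in J,\;x\in\mathcal{U}} M\big((D\phi_s(x)x-\phi(s,x))/x\big)$$ (with the convention that $\alpha=-\infty$ means that no real constant works).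
   Context: $\mathcal{X}$ is a real or complex Banach space with norm $|\cdot|$, and $\mathcal{C}\subset\mathcal{X}$ is a closed pointed convex cone ($a\mathcal{C}\subset\mathcal{C}$ for $a\ge 0$, $\mathcal{C}+\mathcal{C}\subset\mathcal{C}$, $\mathcal{C}\cap(-\mathcal{C})=\{0\}$) with nonempty interior $\mathcal{C}_0$. Write $x\leq y$ iff $y-x\in\mathcal{C}$. For $x\in\mathcal{X}$, $y\in\mathcal{C}_0$ put $M(x/y)=\inf\{t\in\mathbb{R}: x\leq ty\}$. The Thompson metric on $\mathcal{C}_0$ is $d_T(x,y)=\log\max\{M(x/y),M(y/x)\}$. $J=[0,T)$ with $0<T\leq\infty$, $\mathcal{D}\subset\mathcal{X}$ is open, and $\phi:J\times\mathcal{D}\to\mathcal{X}$ is continuous and Fréchet differentiable in its second variable, with derivative $D\phi_t(x)$ at $(t,x)$; for every closed bounded set $K\subset\mathcal{D}$ there is a constant $L$ with $|D\phi_t(x)|\leq L$ for all $t\in J$, $x\in K$. For $s\in J$, $x_0\in\mathcal{D}$, $M_s^t(x_0)=x(t)$, $t\in[s,a)$, where $x(\cdot)$ is the maximal solution in $\mathcal{D}$ of $\dot x(t)=\phi(t,x(t))$, $x(s)=x_0$. For an open set $\mathcal{U}\subset\mathcal{D}$ and $x_0\in\mathcal{U}$, $t_{\mathcal{U}}(s,x_0)=\sup\{b\in(s,a): M_s^t(x_0)\in\mathcal{U}\ \forall t\in[s,b)\}$. The flow is order-preserving on $\mathcal{U}$ if for all $x_1,x_2\in\mathcal{U}$ with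 $x_1\geq x_2$ one has $M_s^t(x_1)\geq M_s^t(x_2)$ for all $s\in J$ and $s\leq t<\min\{t_{\mathcal{U}}(s,x_1),t_{\mathcal{U}}(s,x_2)\}$. *)

(* Defs.v *)
From Stdlib Require Import Reals ClassicalEpsilon.
From Coquelicot Require Import Coquelicot.

Open Scope R_scope.

Inductive scalar_kind : Set := RealScalars | ComplexScalars.

Definition scalar_field (k : scalar_kind) : AbsRing :=
  match k with RealScalars => R_AbsRing | ComplexScalars => C_AbsRing end.

Definition of_real (k : scalar_kind) : R -> scalar_field k :=
  match k with RealScalars => fun a => a | ComplexScalars => RtoC end.

Definition rscal {k : scalar_kind} {X : CompleteNormedModule (scalar_field k)}
  (a : R) (x : X) : X := scal (of_real k a) x.

Section Cone.

Context {k : scalar_kind} {X : CompleteNormedModule (scalar_field k)}.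
Implicit Types (C : X -> Prop) (x y : X).

Definition cone_interior C : X -> Prop := fun x => locally x C.

Record closed_pointed_cone C : Prop := {
  cone_closed : closed C;
  cone_scal : forall a x, 0 <= a -> C x -> C (rscal a x);
  cone_plus : forall x y, C x -> C y -> C (plus x y);
  cone_zero : C zero;
  cone_pointed : forall x, C x -> C (opp x) -> x = zero
}.

Definition cone_le C x y : Prop := C (minus y x).

Definition thompson_M C x y : Rbar := Glb_Rbar (fun t => cone_le C x (rscal t y)).

(* For [x], [y] in the interior of a closed pointed cone, [thompson_M C x y] is
   a finite number unless [X] is the zero space; in that case both values of
   [thompson_M] are [m_infty], [real] sends them to 0, and the result is
   [ln 0], which is 0 in Stdlib. *)
Definition thompson_dist C x y : R :=
  ln (Rmax (real (thompson_M C x y)) (real (thompson_M C y x))).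

End Cone.

Section Flow.

Context {k : scalar_kind} {X : CompleteNormedModule (scalar_field k)}.

(* The interval [0,T), where [T] may be [p_infty]. *)
Definition time_interval (T : Rbar) (t : R) : Prop := 0 <= t /\ Rbar_lt t T.

Definition bounded_set (K : X -> Prop) : Prop :=
  exists r : R, forall x, K x -> norm x <= r.

(* [phi] and [Dphi] are total functions, but only their values on [0,T) x [D]
   are constrained; differentiability is over the scalar field of [X]. *)
Record regular_field (T : Rbar) (D : X -> Prop)
    (phi : R -> X -> X) (Dphi : R -> X -> X -> X) : Prop := {
  field_continuous : forall t x, time_interval T t -> D x ->
    filterlim (fun p : R * X => phi (fst p) (snd p))
      (within (fun p : R * X => time_interval T (fst p) /\ D (snd p))
         (locally (t, x)))
      (locally (phi t x));
  field_differentiable : forall t x, time_interval T t -> D x ->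
    filterdiff (phi t) (locally x) (Dphi t x);
  field_derivative_bounded : forall K : X -> Prop,
    closed K -> bounded_set K -> (forall x, K x -> D x) ->
    exists L : R, forall t x, time_interval T t -> K x ->
      forall v, norm (Dphi t x v) <= L * norm v
}.

(* [x] solves the initial value problem on [s,b), inside [D].  At [t = s] the
   derivative is one-sided. *)
Definition is_solution (T : Rbar) (D : X -> Prop) (phi : R -> X -> X)
    (s : R) (x0 : X) (b : Rbar) (x : R -> X) : Prop :=
  Rbar_lt s b /\ Rbar_le b T /\ x s = x0 /\
  forall t, s <= t -> Rbar_lt t b ->
    D (x t) /\
    filterlim (fun u => rscal (/ (u - t)) (minus (x u) (x t)))
      (within (fun u => s <= u) (locally' t))
      (locally (phi t (x t))).

Definition is_maximal_solution (T : Rbar) (D : X -> Prop) (phi : R -> X -> X)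
    (s : R) (x0 : X) (a : Rbar) (x : R -> X) : Prop :=
  is_solution T D phi s x0 a x /\
  forall (b : Rbar) (y : R -> X),
    is_solution T D phi s x0 b y ->
    (forall t, s <= t -> Rbar_lt t a -> Rbar_lt t b -> y t = x t) ->
    Rbar_le b a.

(* The right end point of the interval of existence, and the solution itself,
   whose values outside of [s,a) are irrelevant. *)
Definition maximal_solution (T : Rbar) (D : X -> Prop) (phi : R -> X -> X)
    (s : R) (x0 : X) : Rbar * (R -> X) :=
  epsilon (inhabits (Finite s, fun _ => x0))
    (fun p => is_maximal_solution T D phi s x0 (fst p) (snd p)).

Definition life_time (T : Rbar) (D : X -> Prop) (phi : R -> X -> X)
    (s : R) (x0 : X) : Rbar :=
  fst (maximal_solution T D phi s x0).

Definition flow (T : Rbar) (D : X -> Prop) (phi : R -> X -> X)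
    (s t : R) (x0 : X) : X :=
  snd (maximal_solution T D phi s x0) t.

Definition exit_time (T : Rbar) (D : X -> Prop) (phi : R -> X -> X)
    (U : X -> Prop) (s : R) (x0 : X) : Rbar :=
  Lub_Rbar (fun b => s < b /\ Rbar_lt b (life_time T D phi s x0) /\
    forall t, s <= t < b -> U (flow T D phi s t x0)).

Definition order_preserving (C : X -> Prop) (T : Rbar) (D : X -> Prop)
    (phi : R -> X -> X) (U : X -> Prop) : Prop :=
  forall x1 x2, U x1 -> U x2 -> cone_le C x2 x1 ->
  forall s t, time_interval T s -> s <= t ->
    Rbar_lt t (Rbar_min (exit_time T D phi U s x1) (exit_time T D phi U s x2)) ->
    cone_le C (flow T D phi s t x2) (flow T D phi s t x1).

Definition thompson_contracts (C : X -> Prop) (T : Rbar) (D : X -> Prop)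
    (phi : R -> X -> X) (U : X -> Prop) (alpha : R) : Prop :=
  forall x1 x2, U x1 -> U x2 ->
  forall s t, time_interval T s -> s <= t ->
    Rbar_lt t (Rbar_min (exit_time T D phi U s x1) (exit_time T D phi U s x2)) ->
    thompson_dist C (flow T D phi s t x1) (flow T D phi s t x2)
      <= exp (- alpha * (t - s)) * thompson_dist C x1 x2.

End Flow.

(* [m_infty]: no real constant works; [p_infty]: every real constant works
   (this happens only in degenerate cases, such as an empty domain). *)
Definition is_best_constant (P : R -> Prop) (alpha : Rbar) : Prop :=
  match alpha with
  | Finite a => P a /\ forall b, P b -> b <= a
  | p_infty => forall b, P b
  | m_infty => forall b, ~ P b
  end.

(* Main.v *)
Require Import Defs.
From Stdlib Require Import Reals Lra Lia ClassicalEpsilon Classical List PeanoNat.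
From Coquelicot Require Import Coquelicot.

(** The proof goes through a third condition, which integrates the infinitesimal
    one along rays.  Writing [<=] for the order of the cone, the following are
    equivalent for a real [a]:

    - [infinitesimal_rate a]: [Dphi_s(x) x - phi(s,x) <= - a x];
    - [radial_rate a]: [phi(s,x) - phi(s,l x) / l <= a (ln l) x] for [0 < l <= 1];
    - the flow contracts the Thompson metric at rate [a].

    The first two are equivalent because the derivative of [phi(s,nu x) / nu] in
    [nu] is [(Dphi_s(nu x) (nu x) - phi(s,nu x)) / nu^2]: one integrates from [l]
    to [1], staying in [U] because [U] is star-shaped, or differentiates at
    [l = 1] ([infinitesimal_radial], [radial_infinitesimal]).

    From the second to the third ([radial_contracts]): two points at Thompson
    distance [d] satisfy [exp(-d) x2 <= x1] and [exp(-d) x1 <= x2].  Let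
    [mu(t) = exp(- d exp(- a (t - s)))] and let [x2(t)] be a solution.  The
    derivative of [mu x2] is [- a (ln mu) mu x2 + mu phi(t,x2)], which by
    [radial_rate] is at most [phi(t, mu x2)].  So [mu x2] is a subsolution that
    starts below [x1], and [comparison] keeps it below the solution [x1(t)]; with
    the roles exchanged this bounds the distance at time [t] by
    [d exp(- a (t - s))].

    From the third to the second ([contracts_radial]): the points [x] and [l x]
    are at distance at most [- ln l].  The order inequality that expresses the
    contraction is an equality at the starting time, so it may be differentiated
    there.

    The comparison principle is where monotonicity of the flow is used.  On an
    infinitesimal time interval monotonicity says that [p <= q] implies
    [p + h phi(p) <= q + h phi(q) + o(h)] ([quasimonotone]).  A perturbation of
    the solution by a small growing multiple of an interior point of the cone
    absorbs the [o(h)] and the Lipschitz constant of the field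
    ([comparison_local]).

    All this needs the flow to exist: Picard iteration, uniqueness, and gluing of
    the solutions give [flow_maximal].

    Finally [thompson_M w x <= m] means [w <= m x], the cone being closed, so that
    [infinitesimal_rate a] says that the supremum of the theorem is at most [- a].
    A complex space is treated as a real one by restriction of scalars. *)

Open Scope R_scope.

Declare Scope vec_scope.
Delimit Scope vec_scope with V.
Local Notation "x + y" := (plus x y) : vec_scope.
Local Notation "x - y" := (minus x y) : vec_scope.
Local Notation "- x" := (opp x) : vec_scope.
Local Notation "a *: x" := (scal a%R x) (at level 40, left associativity) : vec_scope.
Local Notation "0" := zero : vec_scope.

(** * Deciding linear identities between vectors *)

Inductive vexp : Type :=
| VVar (n : nat)
| VZero
| VPlus (a b : vexp)
| VMinus (a b : vexp)
| VOpp (a : vexp)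
| VScal (r : R) (a : vexp).

Fixpoint vcoef (e : vexp) (n : nat) : R :=
  match e with
  | VVar m => if Nat.eqb n m then 1 else 0
  | VZero => 0
  | VPlus a b => vcoef a n + vcoef b n
  | VMinus a b => vcoef a n - vcoef b n
  | VOpp a => - vcoef a n
  | VScal r a => r * vcoef a n
  end.

Fixpoint same_coefs (n : nat) (a b : vexp) : Prop :=
  match n with
  | O => True
  | S m => vcoef a m = vcoef b m /\ same_coefs m a b
  end.

Section LinearIdentities.

Context {X : CompleteNormedModule R_AbsRing}.

Fixpoint veval (env : list X) (e : vexp) : X :=
  match e with
  | VVar n => nth n env zero
  | VZero => zero
  | VPlus a b => plus (veval env a) (veval env b)
  | VMinus a b => minus (veval env a) (veval env b)
  | VOpp a => opp (veval env a)
  | VScal r a => scal r (veval env a)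
  end.

Fixpoint lincomb (env : list X) (c : nat -> R) : X :=
  match env with
  | nil => zero
  | cons v l => plus (scal (c O) v) (lincomb l (fun n => c (S n)))
  end.

Lemma lincomb_ext (env : list X) (c d : nat -> R) :
  (forall n, (n < length env)%nat -> c n = d n) -> lincomb env c = lincomb env d.
Proof.
  revert c d; induction env as [|v l IH]; intros c d H; simpl; auto.
  rewrite (H O) by (simpl; lia).
  f_equal; apply IH; intros n Hn; apply H; simpl; lia.
Qed.

Lemma lincomb_zero (env : list X) : lincomb env (fun _ => 0) = zero.
Proof.
  induction env as [|v l IH]; simpl; auto.
  rewrite IH, plus_zero_r; exact (scal_zero_l v).
Qed.

Lemma lincomb_plus (env : list X) (c d : nat -> R) :
  lincomb env (fun n => c n + d n) = plus (lincomb env c) (lincomb env d).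
Proof.
  revert c d; induction env as [|v l IH]; intros c d; simpl.
  - now rewrite plus_zero_l.
  - rewrite (IH (fun n => c (S n)) (fun n => d (S n))).
    assert (H : scal (c O + d O) v = plus (scal (c O) v) (scal (d O) v))
      by exact (scal_distr_r (c O) (d O) v).
    rewrite H, <- !plus_assoc; f_equal.
    rewrite !plus_assoc; f_equal; apply plus_comm.
Qed.

Lemma lincomb_scal (env : list X) (r : R) (c : nat -> R) :
  lincomb env (fun n => r * c n) = scal r (lincomb env c).
Proof.
  revert c; induction env as [|v l IH]; intros c; simpl.
  - symmetry; exact (scal_zero_r r).
  - rewrite (IH (fun n => c (S n))).
    assert (H : scal (r * c O) v = scal r (scal (c O) v))
      by (symmetry; exact (scal_assoc r (c O) v)).
    rewrite H; symmetry; exact (scal_distr_l r _ _).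
Qed.

Lemma lincomb_opp (env : list X) (c : nat -> R) :
  lincomb env (fun n => - c n) = opp (lincomb env c).
Proof.
  transitivity (scal (Ropp 1) (lincomb env c)); [|exact (scal_opp_one _)].
  rewrite <- lincomb_scal; apply lincomb_ext; intros; ring.
Qed.

Lemma lincomb_var (env : list X) (m : nat) :
  lincomb env (fun n => if Nat.eqb n m then 1 else 0) = nth m env zero.
Proof.
  revert m; induction env as [|v l IH]; intros [|m]; simpl; auto.
  - rewrite lincomb_zero, plus_zero_r; exact (scal_one v).
  - rewrite (IH m).
    assert (H : scal 0 v = zero) by exact (scal_zero_l v).
    rewrite H; apply plus_zero_l.
Qed.

Lemma veval_lincomb (env : list X) (e : vexp) : veval env e = lincomb env (vcoef e).
Proof.
  induction e as [n| |a IHa b IHb|a IHa b IHb|a IHa|r a IHa]; simpl.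
  - symmetry; apply lincomb_var.
  - symmetry; apply lincomb_zero.
  - now rewrite IHa, IHb, <- lincomb_plus.
  - unfold minus; rewrite IHa, IHb, <- lincomb_opp, <- lincomb_plus; reflexivity.
  - now rewrite IHa, <- lincomb_opp.
  - now rewrite IHa, <- lincomb_scal.
Qed.

Lemma same_coefs_nth (N : nat) (a b : vexp) :
  same_coefs N a b -> forall n, (n < N)%nat -> vcoef a n = vcoef b n.
Proof.
  induction N as [|N IH]; intros H n Hn; [lia|].
  destruct H as [H1 H2]; destruct (Nat.eq_dec n N) as [->|]; auto.
  apply IH; auto; lia.
Qed.

(** This turns an identity between vectors into one identity between real numbers
    for each atom; it is the soundness of the tactic [vec]. *)
Lemma veval_eq (env : list X) (a b : vexp) :
  same_coefs (length env) a b -> veval env a = veval env b.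
Proof.
  intros H; rewrite !veval_lincomb; apply lincomb_ext.
  now apply same_coefs_nth.
Qed.

End LinearIdentities.

(* Atoms are compared up to conversion: the same vector may be seen through
   different projections of the algebraic hierarchy. *)
Ltac vec_same v w :=
  match constr:(Set) with
  | _ => let _ := constr:(eq_refl : v = w) in constr:(true)
  | _ => constr:(false)
  end.

Ltac vec_mem v l :=
  lazymatch l with
  | nil => constr:(false)
  | cons ?w ?l' =>
      let b := vec_same v w in
      lazymatch b with true => constr:(true) | false => vec_mem v l' end
  end.

Ltac vec_index v l :=
  lazymatch l with
  | cons ?w ?l' =>
      let b := vec_same v w in
      lazymatch b with
      | true => constr:(O)
      | false => let n := vec_index v l' in constr:(S n)
      end
  end.

Ltac vec_atoms l e :=
  lazymatch e with
  | plus ?a ?b => let l := vec_atoms l a in vec_atoms l b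
  | minus ?a ?b => let l := vec_atoms l a in vec_atoms l b
  | opp ?a => vec_atoms l a
  | scal _ ?a => vec_atoms l a
  | zero => l
  | ?v => lazymatch vec_mem v l with true => l | false => constr:(cons v l) end
  end.

Ltac vec_reify l e :=
  lazymatch e with
  | plus ?a ?b =>
      let a := vec_reify l a in let b := vec_reify l b in constr:(VPlus a b)
  | minus ?a ?b =>
      let a := vec_reify l a in let b := vec_reify l b in constr:(VMinus a b)
  | opp ?a => let a := vec_reify l a in constr:(VOpp a)
  | scal ?r ?a => let a := vec_reify l a in constr:(VScal r a)
  | zero => constr:(VZero)
  | ?v => let n := vec_index v l in constr:(VVar n)
  end.

(* The argument [tac] has to compare the coefficients. *)
Ltac vec_with tac :=
  lazymatch goal with
  | |- @eq ?T ?a ?b =>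
      let l := vec_atoms (@nil T) a in
      let l := vec_atoms l b in
      let ra := vec_reify l a in
      let rb := vec_reify l b in
      change (veval l ra = veval l rb);
      apply veval_eq;
      cbv [same_coefs vcoef length Nat.eqb];
      repeat split; tac
  end.

(** [vec] proves an equation between linear expressions; that denominators do not
    vanish has to follow by [lra] from the context. *)
Ltac vec := vec_with ltac:(first [ring | field; lra]).


(** * Real induction and one-sided calculus *)

(** The supremum of the [t] up to which [P] has been reached cannot stop before
    [b].  The mean value inequalities, the uniqueness of solutions and the
    comparison with subsolutions are instances. *)
Lemma real_induction (a b : R) (P : R -> Prop) :
  P a ->
  (forall t, a < t <= b -> (forall u, a <= u < t -> P u) -> P t) ->
  (forall t, a <= t < b -> P t ->
     exists delta, 0 < delta /\ forall u, t < u < t + delta -> u <= b -> P u) ->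
  forall t, a <= t <= b -> P t.
Proof.
  intros Pa Pleft Pright t0 Ht0.
  set (E := fun t => a <= t <= b /\ forall u, a <= u <= t -> P u).
  assert (Ea : E a).
  { split; [lra|]. intros u Hu; replace u with a by lra; exact Pa. }
  destruct (completeness E) as [m [Hub Hlub]].
  { exists b; intros t [Ht _]; lra. }
  { now exists a. }
  assert (Ham : a <= m) by now apply Hub.
  assert (Hmb : m <= b) by (apply Hlub; intros t [Ht _]; lra).
  assert (Hbelow : forall u, a <= u < m -> P u).
  { intros u Hu; apply NNPP; intros HP.
    assert (m <= u); [|lra].
    apply Hlub; intros t [Ht HE].
    destruct (Rle_dec t u) as [H|H]; auto.
    exfalso; apply HP, HE; lra. }
  assert (Pm : P m).
  { destruct (Req_dec a m) as [<-|Hne]; auto.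
    apply Pleft; auto; lra. }
  destruct (Rle_lt_dec b m) as [Hbm|Hbm].
  - destruct (Rlt_dec t0 m) as [H|H]; [apply Hbelow; lra|].
    replace t0 with m by lra; exact Pm.
  - exfalso.
    destruct (Pright m) as [d [Hd HP]]; [lra|exact Pm|].
    set (t1 := Rmin b (m + d / 2)).
    assert (Ht1 : m < t1 <= b /\ t1 < m + d).
    { unfold t1; split; [split; [apply Rmin_glb_lt; lra|apply Rmin_l]|].
      eapply Rle_lt_trans; [apply Rmin_r|lra]. }
    assert (t1 <= m); [|lra].
    apply Hub; split; [lra|]. intros u Hu.
    destruct (Rtotal_order u m) as [H|[->|H]]; auto.
    + apply Hbelow; lra.
    + apply HP; lra.
Qed.

Section Calculus.

Context {X : CompleteNormedModule R_AbsRing}.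
Implicit Types (x y : R -> X) (u v w : X).

Lemma norm_scal_le (a : R) v : norm (scal a v) <= Rabs a * norm v.
Proof. exact (norm_scal a v). Qed.

Lemma norm_le_eq u v a : u = v -> norm v <= a -> norm u <= a.
Proof. now intros ->. Qed.

Lemma norm_plus_le u v w a b :
  u = plus v w -> norm v <= a -> norm w <= b -> norm u <= a + b.
Proof.
  intros -> Ha Hb; eapply Rle_trans; [exact (norm_triangle v w)|lra].
Qed.

Lemma vnorm_zero : norm (zero : X) = 0.
Proof. exact norm_zero. Qed.

Lemma vnorm_opp v : norm (opp v) = norm v.
Proof. exact (norm_opp v). Qed.

Lemma norm_minus_diag v : norm (minus v v) = 0.
Proof.
  replace (minus v v) with (zero : X) by vec; exact vnorm_zero.
Qed.

Lemma norm_minus_comm v w : norm (minus v w) = norm (minus w v).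
Proof. transitivity (norm (opp (minus w v))); [f_equal; vec|apply vnorm_opp]. Qed.

Lemma eq_of_norm v w : (forall eps, 0 < eps -> norm (minus v w) <= eps) -> v = w.
Proof.
  intros H.
  assert (H0 : minus v w = zero).
  { apply (norm_eq_zero (minus v w)), Rle_antisym; [|apply norm_ge_0].
    apply le_epsilon; intros eps He; rewrite Rplus_0_l; now apply H. }
  transitivity (plus (minus v w) w); [vec|rewrite H0; vec].
Qed.

Lemma locally_of_norm (v : X) (P : X -> Prop) (eps : R) :
  0 < eps -> (forall w, norm (minus w v) < eps -> P w) -> locally v P.
Proof.
  intros He H; apply (locally_le_locally_norm v P).
  exists (mkposreal _ He); intros w Hw; now apply H.
Qed.

Lemma norm_of_locally (v : X) (P : X -> Prop) :
  locally v P -> exists eps, 0 < eps /\ forall w, norm (minus w v) <= eps -> P w.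
Proof.
  intros H; apply (locally_norm_le_locally v P) in H; destruct H as [e He].
  exists (e / 2); split; [apply is_pos_div_2|].
  intros w Hw; apply He; apply (Rle_lt_trans _ _ _ Hw).
  assert (He0 := cond_pos e); lra.
Qed.

Lemma closed_approx (C : X -> Prop) v :
  closed C -> (forall eps, 0 < eps -> exists w, norm (minus w v) <= eps /\ C w) -> C v.
Proof.
  intros HC H; apply HC; intros Hloc.
  destruct (norm_of_locally _ _ Hloc) as [eps [He Hn]].
  destruct (H eps He) as [w [Hw Cw]]; exact (Hn w Hw Cw).
Qed.

(** Only times after [s] count, so that one notion serves for a solution at its
    starting time and at later times. *)
Definition deriv_from (s : R) x (t : R) v : Prop :=
  forall eps, 0 < eps -> exists delta, 0 < delta /\ forall r, s <= r ->
    Rabs (r - t) < delta ->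
    norm (x r - x t - (r - t) *: v)%V <= eps * Rabs (r - t).

Lemma deriv_from_weaken s s' x t v :
  s <= s' -> deriv_from s x t v -> deriv_from s' x t v.
Proof.
  intros Hs H eps He; destruct (H eps He) as [d [Hd Hr]].
  exists d; split; auto; intros r Hsr; apply Hr; lra.
Qed.

Lemma deriv_from_eq s x t v w : deriv_from s x t v -> v = w -> deriv_from s x t w.
Proof. now intros H <-. Qed.

Lemma deriv_from_ext s x y t v (b : R) :
  t < b -> (forall r, s <= r < b -> x r = y r) -> s <= t ->
  deriv_from s x t v -> deriv_from s y t v.
Proof.
  intros Hb Heq Hst H eps He; destruct (H eps He) as [d [Hd Hr]].
  exists (Rmin d (b - t)); split; [apply Rmin_pos; lra|].
  intros r Hsr Hrt.
  assert (H1 := Rmin_l d (b - t)); assert (H2 := Rmin_r d (b - t)).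
  assert (Hrb : r < b) by (apply Rabs_def2 in Hrt; lra).
  rewrite <- !Heq by lra; apply Hr; lra.
Qed.

Lemma deriv_from_continuous s x t v :
  deriv_from s x t v ->
  forall eps, 0 < eps -> exists delta, 0 < delta /\ forall r, s <= r ->
    Rabs (r - t) < delta -> norm (minus (x r) (x t)) <= eps.
Proof.
  intros H eps He; destruct (H 1 Rlt_0_1) as [d [Hd Hr]].
  assert (Hv : 0 <= norm v) by apply norm_ge_0.
  assert (Hq : 0 < eps / (1 + norm v)) by (apply Rdiv_lt_0_compat; lra).
  exists (Rmin d (eps / (1 + norm v))); split; [now apply Rmin_pos|].
  intros r Hsr Hrt.
  assert (H1 := Rmin_l d (eps / (1 + norm v))).
  assert (H2 := Rmin_r d (eps / (1 + norm v))).
  replace eps with (1 * (eps / (1 + norm v)) + eps / (1 + norm v) * norm v)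
    by (field; lra).
  apply (norm_plus_le _ (x r - x t - (r - t) *: v)%V ((r - t) *: v)%V); [vec| |].
  - eapply Rle_trans; [apply Hr; lra|]. lra.
  - eapply Rle_trans; [apply norm_scal_le|].
    apply Rmult_le_compat_r; lra.
Qed.

Lemma deriv_from_const s t v : deriv_from s (fun _ => v) t zero.
Proof.
  intros eps He; exists 1; split; [lra|]. intros r _ _.
  apply (norm_le_eq _ zero); [vec|].
  rewrite vnorm_zero; apply Rmult_le_pos; [lra|apply Rabs_pos].
Qed.

Lemma deriv_from_plus s x y t v w :
  deriv_from s x t v -> deriv_from s y t w ->
  deriv_from s (fun r => plus (x r) (y r)) t (plus v w).
Proof.
  intros Hx Hy eps He.
  destruct (Hx (eps / 2)) as [d [Hd Hr]]; [lra|].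
  destruct (Hy (eps / 2)) as [d' [Hd' Hr']]; [lra|].
  exists (Rmin d d'); split; [now apply Rmin_pos|].
  intros r Hsr Hrt.
  assert (H1 := Rmin_l d d'); assert (H2 := Rmin_r d d').
  replace (eps * Rabs (r - t)) with (eps / 2 * Rabs (r - t) + eps / 2 * Rabs (r - t))
    by field.
  apply (norm_plus_le _ (x r - x t - (r - t) *: v)%V (y r - y t - (r - t) *: w)%V);
    [vec|apply Hr; lra|apply Hr'; lra].
Qed.

(** The defect of the product splits into those of the factors and the term
    [(r - t) (mu r - mu t) v] of second order. *)
Lemma deriv_from_scal s (mu : R -> R) (dmu : R) x t v :
  is_derive mu t dmu -> deriv_from s x t v ->
  deriv_from s (fun r => scal (mu r) (x r)) t (plus (scal dmu (x t)) (scal (mu t) v)).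
Proof.
  intros Hmu Hx eps He.
  assert (Hxt : 0 <= norm (x t)) by apply norm_ge_0.
  assert (Hv : 0 <= norm v) by apply norm_ge_0.
  assert (Hm : 0 <= Rabs (mu t)) by apply Rabs_pos.
  assert (Hmu_t : 0 < Rabs (mu t) + 1) by lra.
  destruct (Hx (eps / 3 / (Rabs (mu t) + 1))) as [d1 [Hd1 H1]].
  { apply Rdiv_lt_0_compat; lra. }
  assert (Hmu1 := proj2 Hmu t (fun P H => H)).
  assert (Hq : 0 < eps / 3 / (norm (x t) + 1)) by (apply Rdiv_lt_0_compat; lra).
  destruct (Hmu1 (mkposreal _ Hq)) as [d2 H2]; simpl in H2.
  assert (Hcont : continuous mu t) by (apply (ex_derive_continuous mu); now exists dmu).
  assert (Hq' : 0 < Rmin 1 (eps / 3 / (norm v + 1))).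
  { apply Rmin_pos; [lra|apply Rdiv_lt_0_compat; lra]. }
  destruct (proj1 (filterlim_locally mu (mu t)) Hcont (mkposreal _ Hq')) as [d3 H3].
  simpl in H3.
  assert (Hd2 := cond_pos d2); assert (Hd3 := cond_pos d3).
  exists (Rmin d1 (Rmin d2 d3)); split; [repeat apply Rmin_pos; auto|].
  intros r Hsr Hrt.
  assert (A1 := Rmin_l d1 (Rmin d2 d3)); assert (A2 := Rmin_r d1 (Rmin d2 d3)).
  assert (A3 := Rmin_l d2 d3); assert (A4 := Rmin_r d2 d3).
  specialize (H1 r Hsr ltac:(lra)).
  assert (B2 : Rabs (mu r - mu t - (r - t) * dmu)
               <= eps / 3 / (norm (x t) + 1) * Rabs (r - t)).
  { assert (Hb : ball t d2 r) by (change (Rabs (r - t) < d2); lra).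
    exact (H2 r Hb). }
  assert (B3 : Rabs (mu r - mu t) < Rmin 1 (eps / 3 / (norm v + 1))).
  { assert (Hb : ball t d3 r) by (change (Rabs (r - t) < d3); lra).
    exact (H3 r Hb). }
  assert (C1 := Rmin_l 1 (eps / 3 / (norm v + 1))).
  assert (C2 := Rmin_r 1 (eps / 3 / (norm v + 1))).
  assert (Hr := Rabs_pos (r - t)).
  replace (eps * Rabs (r - t)) with
    (eps / 3 * Rabs (r - t) + (eps / 3 * Rabs (r - t) + eps / 3 * Rabs (r - t))) by field.
  apply (norm_plus_le _ (mu r *: (x r - x t - (r - t) *: v))%V
    ((mu r - mu t - (r - t) * dmu) *: x t + (r - t) *: ((mu r - mu t) *: v))%V); [vec| |].
  - eapply Rle_trans; [apply norm_scal_le|].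
    assert (Hmr : Rabs (mu r) <= Rabs (mu t) + 1).
    { replace (mu r) with (mu t + (mu r - mu t)) by ring.
      eapply Rle_trans; [apply Rabs_triang|lra]. }
    eapply Rle_trans.
    { apply Rmult_le_compat; [apply Rabs_pos|apply norm_ge_0|exact Hmr|exact H1]. }
    apply Req_le; field; lra.
  - eapply norm_plus_le; [reflexivity| |].
    + eapply Rle_trans; [apply norm_scal_le|].
      eapply Rle_trans; [apply Rmult_le_compat_r; [exact Hxt|exact B2]|].
      replace (eps / 3 / (norm (x t) + 1) * Rabs (r - t) * norm (x t))
        with (eps / 3 * Rabs (r - t) * (norm (x t) / (norm (x t) + 1))) by (field; lra).
      rewrite <- (Rmult_1_r (eps / 3 * Rabs (r - t))) at 2.
      apply Rmult_le_compat_l; [apply Rmult_le_pos; lra|].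
      apply Rle_div_l; lra.
    + eapply Rle_trans; [apply norm_scal_le|].
      rewrite (Rmult_comm (eps / 3)); apply Rmult_le_compat_l; auto.
      eapply Rle_trans; [apply norm_scal_le|].
      eapply Rle_trans; [apply Rmult_le_compat_r; [exact Hv|]|].
      { apply Rlt_le, Rlt_le_trans with (1 := B3); exact C2. }
      replace (eps / 3 / (norm v + 1) * norm v) with (eps / 3 * (norm v / (norm v + 1)))
        by (field; lra).
      rewrite <- (Rmult_1_r (eps / 3)) at 2.
      apply Rmult_le_compat_l; [lra|]. apply Rle_div_l; lra.
Qed.

Lemma deriv_from_scal_const s (a : R) x t v :
  deriv_from s x t v -> deriv_from s (fun r => scal a (x r)) t (scal a v).
Proof.
  intros H; eapply deriv_from_eq.
  - apply (deriv_from_scal s (fun _ => a) 0); [apply is_derive_Reals; apply derivable_pt_lim_const|exact H].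
  - vec.
Qed.

Lemma deriv_from_minus s x y t v w :
  deriv_from s x t v -> deriv_from s y t w ->
  deriv_from s (fun r => minus (x r) (y r)) t (minus v w).
Proof.
  intros Hx Hy.
  apply (deriv_from_scal_const s (-1)) in Hy.
  assert (H := deriv_from_plus _ _ _ _ _ _ Hx Hy).
  intros eps He; destruct (H eps He) as [d [Hd Hr]].
  exists d; split; auto; intros r Hsr Hrt; specialize (Hr r Hsr Hrt).
  eapply norm_le_eq; [|exact Hr]; vec.
Qed.

Lemma filterdiff_along (g l : X -> X) (q w : X) (s t : R) :
  filterdiff g (locally (plus q (scal t w))) l ->
  deriv_from s (fun r => g (plus q (scal r w))) t (l w).
Proof.
  intros [Hl Hg] eps He.
  set (p := plus q (scal t w)) in *.
  assert (Hw : 0 <= norm w) by apply norm_ge_0.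
  assert (Hq : 0 < eps / (norm w + 1)) by (apply Rdiv_lt_0_compat; lra).
  destruct (norm_of_locally _ _ (Hg p (fun P H => H) (mkposreal _ Hq))) as [d [Hd Hgd]].
  simpl in Hgd.
  exists (d / (norm w + 1)); split; [apply Rdiv_lt_0_compat; lra|].
  intros r _ Hrt.
  assert (Hz : minus (plus q (scal r w)) p = scal (r - t) w) by (unfold p; vec).
  assert (Hn : norm (scal (r - t) w) <= Rabs (r - t) * norm w) by apply norm_scal_le.
  assert (Hr0 := Rabs_pos (r - t)).
  assert (Hs : l (scal (r - t) w) = scal (r - t) (l w))
    by exact (linear_scal l Hl (r - t) w).
  specialize (Hgd (plus q (scal r w))).
  change (norm (minus (plus q (scal r w)) p) <= d ->
    norm (minus (minus (g (plus q (scal r w))) (g p)) (l (minus (plus q (scal r w)) p)))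
      <= eps / (norm w + 1) * norm (minus (plus q (scal r w)) p)) in Hgd.
  rewrite Hz, Hs in Hgd.
  eapply Rle_trans; [apply Hgd|].
  - apply Rlt_div_r in Hrt; [|lra]. nra.
  - replace (eps * Rabs (r - t)) with
      (eps / (norm w + 1) * (Rabs (r - t) * (norm w + 1))) by (field; lra).
    apply Rmult_le_compat_l; [lra|]. nra.
Qed.

Lemma is_derive_deriv_from s x t v : is_derive x t v -> deriv_from s x t v.
Proof.
  intros [_ H] eps He.
  destruct (H t (fun P H => H) (mkposreal _ He)) as [d Hd].
  exists d; split; [apply cond_pos|].
  intros r _ Hrt; exact (Hd r Hrt).
Qed.

(** Mean value inequality.  The slope is enlarged to [K + eps] so that the
    inequality propagates to the right across the [o(h)] of the derivative. *)
Lemma norm_mean_value (a b : R) x (dx : R -> X) (K : R) :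
  a <= b -> (forall t, a <= t <= b -> deriv_from a x t (dx t)) ->
  (forall t, a <= t <= b -> norm (dx t) <= K) ->
  norm (minus (x b) (x a)) <= K * (b - a).
Proof.
  intros Hab Hd HK.
  apply le_epsilon; intros eta Heta.
  set (eps := eta / (b - a + 1)).
  assert (Heps : 0 < eps) by (apply Rdiv_lt_0_compat; lra).
  assert (H : forall t, a <= t <= b -> norm (minus (x t) (x a)) <= (K + eps) * (t - a)).
  { apply real_induction.
    - rewrite norm_minus_diag; lra.
    - intros t Ht IH; apply le_epsilon; intros z Hz.
      destruct (deriv_from_continuous _ _ _ _ (Hd t ltac:(lra)) z Hz) as [d [Hd0 Hc]].
      set (r := Rmax a (t - d / 2)).
      assert (Hr : a <= r < t /\ t - r < d).
      { unfold r; apply Rmax_case_strong; lra. }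
      rewrite Rplus_comm.
      apply (norm_plus_le _ (x t - x r)%V (x r - x a)%V); [vec| |].
      + rewrite norm_minus_comm; apply Hc; [lra|].
        apply Rabs_def1; lra.
      + eapply Rle_trans; [apply IH; lra|].
        assert (0 <= K) by (apply Rle_trans with (norm (dx t)); [apply norm_ge_0|apply (HK t); lra]).
        apply Rmult_le_compat_l; lra.
    - intros t Ht IH.
      destruct (Hd t ltac:(lra) eps Heps) as [d [Hd0 Hr]].
      exists d; split; auto; intros u Hu Hub.
      specialize (Hr u ltac:(lra)); rewrite (Rabs_pos_eq (u - t)) in Hr by lra.
      specialize (Hr ltac:(lra)).
      replace ((K + eps) * (u - a)) with
        ((K + eps) * (t - a) + ((u - t) * K + eps * (u - t))) by ring.
      apply (norm_plus_le _ (x t - x a)%V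
        ((u - t) *: dx t + (x u - x t - (u - t) *: dx t))%V); [vec|auto|].
      eapply norm_plus_le; [reflexivity| |exact Hr].
      eapply Rle_trans; [apply norm_scal_le|].
      rewrite Rabs_pos_eq by lra; apply Rmult_le_compat_l; [lra|apply HK; lra]. }
  eapply Rle_trans; [apply H; lra|].
  rewrite Rmult_plus_distr_r; apply Rplus_le_compat_l.
  unfold eps; unfold Rdiv; rewrite Rmult_assoc.
  rewrite <- (Rmult_1_r eta) at 2; apply Rmult_le_compat_l; [lra|].
  rewrite Rmult_comm; apply Rle_div_l; lra.
Qed.

End Calculus.

(** * The Picard iteration *)

Lemma half_pow_small (c eps : R) : 0 < eps -> exists n, c * (1 / 2) ^ n <= eps.
Proof.
  intros He.
  assert (Hc : 0 <= Rabs c) by apply Rabs_pos.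
  assert (Hh : Rabs (1 / 2) < 1) by (rewrite Rabs_pos_eq; lra).
  assert (Hq : 0 < eps / (Rabs c + 1)) by (apply Rdiv_lt_0_compat; lra).
  destruct (pow_lt_1_zero _ Hh _ Hq) as [N HN].
  exists N; specialize (HN N (Nat.le_refl N)).
  assert (Hp : 0 < (1 / 2) ^ N) by (apply pow_lt; lra).
  rewrite Rabs_pos_eq in HN by lra.
  apply Rlt_div_r in HN; [|lra].
  assert (Hle := Rle_abs c). nra.
Qed.

Section Picard.

Context {X : CompleteNormedModule R_AbsRing}.

(** The increments are summable, so completeness gives the limit; the sum of the
    remaining increments gives the rate. *)
Lemma geometric_limit (u : nat -> X) (r : R) :
  (forall n, norm (minus (u (S n)) (u n)) <= r * (1 / 2) ^ n) ->
  exists l, forall n, norm (minus (u n) l) <= 2 * r * (1 / 2) ^ n.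
Proof.
  intros H.
  set (a := fun n => minus (u (S n)) (u n)).
  destruct (ex_series_le a (fun n => r * (1 / 2) ^ n)) as [l0 Hl0].
  { exact H. }
  { apply (ex_series_scal_l r (fun n => (1 / 2) ^ n)), ex_series_geom.
    rewrite Rabs_pos_eq; lra. }
  assert (Hsum : forall n, sum_n a n = minus (u (S n)) (u O)).
  { induction n as [|n IH].
    - now rewrite sum_O.
    - rewrite sum_Sn, IH; unfold a.
      change (plus (minus (u (S n)) (u O)) (minus (u (S (S n))) (u (S n)))
              = minus (u (S (S n))) (u O)).
      vec. }
  exists (plus (u O) l0); intros n.
  assert (Htail : forall m, norm (minus (u n) (u (n + m)%nat))
                    <= 2 * r * ((1 / 2) ^ n - (1 / 2) ^ (n + m))).
  { induction m as [|m IH].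
    - rewrite Nat.add_0_r, norm_minus_diag; lra.
    - rewrite Nat.add_succ_r; simpl pow.
      replace (2 * r * ((1 / 2) ^ n - 1 / 2 * (1 / 2) ^ (n + m))) with
        (2 * r * ((1 / 2) ^ n - (1 / 2) ^ (n + m)) + r * (1 / 2) ^ (n + m)) by field.
      apply (norm_plus_le _ (u n - u (n + m)%nat)%V (u (n + m)%nat - u (S (n + m)))%V);
        [vec|exact IH|rewrite norm_minus_comm; apply H]. }
  apply le_epsilon; intros eps He.
  destruct (Hl0 (fun w => norm (minus w l0) < eps)) as [N HN].
  { apply (locally_of_norm _ _ eps He); auto. }
  specialize (HN (n + N)%nat ltac:(lia)); rewrite Hsum in HN.
  specialize (Htail (S N)).
  eapply norm_plus_le with (v := minus (u n) (u (n + S N)%nat))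
    (w := minus (minus (u (S (n + N))) (u O)) l0).
  - rewrite Nat.add_succ_r; vec.
  - eapply Rle_trans; [exact Htail|].
    assert (Hp : 0 < (1 / 2) ^ (n + S N)) by (apply pow_lt; lra).
    assert (0 <= r).
    { assert (H0 := H O); simpl in H0.
      assert (H1 := norm_ge_0 (minus (u 1%nat) (u O))). lra. }
    nra.
  - apply Rlt_le, HN.
Qed.

(** The data of a Picard iteration for [x' = f(t,x)] on [[s,s+delta]], in the
    closed ball of radius [r] around the initial value [p]. *)
Variables (f : R -> X -> X) (s delta r B L : R) (p : X).
Hypothesis delta_pos : 0 < delta.
Hypothesis L_pos : 0 <= L.
Hypothesis B_pos : 0 <= B.
Hypothesis stay : B * delta <= r.
Hypothesis contraction : L * delta <= 1 / 2.
Hypothesis f_bound : forall (t : R) (x : X), s <= t <= s + delta -> norm (minus x p) <= r ->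
  norm (f t x) <= B.
Hypothesis f_lipschitz : forall (t : R) (x y : X), s <= t <= s + delta ->
  norm (minus x p) <= r -> norm (minus y p) <= r ->
  norm (minus (f t x) (f t y)) <= L * norm (minus x y).
Hypothesis f_continuous : forall (t : R) (x : X), s <= t <= s + delta -> norm (minus x p) <= r ->
  forall eps, 0 < eps -> exists eta, 0 < eta /\ forall (t' : R) (x' : X),
    s <= t' <= s + delta -> norm (minus x' p) <= r ->
    Rabs (t' - t) < eta -> norm (minus x' x) < eta ->
    norm (minus (f t' x') (f t x)) <= eps.

Let clamp (t : R) : R := Rmax s (Rmin t (s + delta)).

Lemma clamp_in t : s <= clamp t <= s + delta.
Proof.
  unfold clamp; split; [apply Rmax_l|].
  apply Rmax_lub; [lra|apply Rmin_r].
Qed.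

Lemma clamp_id t : s <= t <= s + delta -> clamp t = t.
Proof.
  intros Ht; unfold clamp; rewrite Rmin_left, Rmax_right; lra.
Qed.

Lemma clamp_lipschitz t u : Rabs (clamp t - clamp u) <= Rabs (t - u).
Proof.
  unfold clamp, Rmax, Rmin.
  repeat destruct Rle_dec; unfold Rabs; repeat destruct Rcase_abs; lra.
Qed.

Definition admissible (x : R -> X) : Prop :=
  x s = p /\ forall t u, s <= t <= s + delta -> s <= u <= s + delta ->
    norm (minus (x t) (x u)) <= B * Rabs (t - u).

Lemma admissible_ball x t : admissible x -> s <= t <= s + delta ->
  norm (minus (x t) p) <= r.
Proof.
  intros [Hs Hx] Ht; rewrite <- Hs.
  eapply Rle_trans; [apply Hx; lra|].
  rewrite Rabs_pos_eq by lra. nra.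
Qed.

(** Composing with [clamp] makes the integrand continuous on the whole line, so
    that the integral is differentiable on both sides at every time. *)
Definition integrand (x : R -> X) (t : R) : X := f (clamp t) (x (clamp t)).

Definition picard (x : R -> X) (t : R) : X := plus p (RInt (integrand x) s t).

Lemma integrand_continuous x t : admissible x -> continuous (integrand x) t.
Proof.
  intros Hx.
  assert (Hc := clamp_in t).
  intros P HP.
  destruct (norm_of_locally _ _ HP) as [eps [He HeP]].
  destruct (f_continuous (clamp t) (x (clamp t)) Hc (admissible_ball _ _ Hx Hc) eps He)
    as [eta [Heta Hf]].
  assert (Hq : 0 < eta / (B + 1)) by (apply Rdiv_lt_0_compat; lra).
  exists (mkposreal _ Hq); intros u Hu.
  assert (Hu' : Rabs (u - t) < eta / (B + 1)) by exact Hu.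
  apply HeP, Hf; [apply clamp_in|apply admissible_ball; [auto|apply clamp_in]| |].
  - eapply Rle_lt_trans; [apply clamp_lipschitz|].
    eapply Rlt_le_trans; [exact Hu'|]. apply Rle_div_l; [lra|]. nra.
  - eapply Rle_lt_trans; [apply Hx; [apply clamp_in|exact Hc]|].
    assert (H1 := clamp_lipschitz u t); assert (H0 := Rabs_pos (clamp u - clamp t)).
    apply Rlt_div_r in Hu'; [|lra]. nra.
Qed.

Lemma integrand_ex_RInt x a b : admissible x -> ex_RInt (integrand x) a b.
Proof.
  intros Hx; apply (ex_RInt_continuous (integrand x)).
  intros z _; now apply integrand_continuous.
Qed.

Lemma picard_derive x t : admissible x -> is_derive (picard x) t (integrand x t).
Proof.
  intros Hx.
  assert (H : is_derive (RInt (integrand x) s) t (integrand x t)).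
  { apply is_derive_RInt with (a := s).
    - exists (mkposreal 1 Rlt_0_1); intros b _.
      apply (RInt_correct (integrand x)), integrand_ex_RInt, Hx.
    - now apply integrand_continuous. }
  assert (H1 := is_derive_plus (fun _ => p) (RInt (integrand x) s) t zero _
                  (is_derive_const p t) H).
  replace (integrand x t) with (plus zero (integrand x t)) by vec; exact H1.
Qed.

Lemma picard_admissible x : admissible x -> admissible (picard x).
Proof.
  intros Hx; split.
  - unfold picard; rewrite RInt_point; vec.
  - intros t u Ht Hu; unfold picard.
    assert (HC : plus (RInt (integrand x) s u) (RInt (integrand x) u t)
                 = RInt (integrand x) s t)
      by (apply (RInt_Chasles (integrand x)); now apply integrand_ex_RInt).
    apply (norm_le_eq _ (RInt (integrand x) u t)); [rewrite <- HC; vec|].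
    rewrite (Rmult_comm B).
    apply (norm_RInt_le_const_abs (integrand x) u t).
    + intros z _; apply f_bound; [apply clamp_in|].
      apply admissible_ball; [auto|apply clamp_in].
    + apply (RInt_correct (integrand x)), integrand_ex_RInt, Hx.
Qed.

(** The factor [1/2] is the bound on [L delta]. *)
Lemma picard_contracts x y M :
  admissible x -> admissible y ->
  (forall t, s <= t <= s + delta -> norm (minus (x t) (y t)) <= M) ->
  forall t, s <= t <= s + delta -> norm (minus (picard x t) (picard y t)) <= M / 2.
Proof.
  intros Hx Hy HM t Ht; unfold picard.
  apply (norm_le_eq _ (minus (RInt (integrand x) s t) (RInt (integrand y) s t))); [vec|].
  assert (HM0 : 0 <= M).
  { apply Rle_trans with (norm (minus (x t) (y t))); [apply norm_ge_0|auto]. }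
  apply Rle_trans with ((t - s) * (L * M)).
  - apply (norm_RInt_le_const (fun u => minus (integrand x u) (integrand y u)) s t).
    + lra.
    + intros u Hu.
      assert (Hcu := clamp_in u).
      eapply Rle_trans.
      { apply f_lipschitz; [auto|now apply admissible_ball|now apply admissible_ball]. }
      apply Rmult_le_compat_l; auto.
    + apply (is_RInt_minus (integrand x) (integrand y));
        apply (RInt_correct (integrand _)); now apply integrand_ex_RInt.
  - apply Rle_trans with (delta * (L * M)); [|nra].
    apply Rmult_le_compat_r; [|lra]. now apply Rmult_le_pos.
Qed.

Let iterate (n : nat) : R -> X := Nat.iter n picard (fun _ => p).

Lemma iterate_admissible n : admissible (iterate n).
Proof.
  induction n as [|n IH]; [|now apply picard_admissible].
  split; auto; intros t u _ _; simpl.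
  rewrite norm_minus_diag; apply Rmult_le_pos; [auto|apply Rabs_pos].
Qed.

Lemma iterate_step n t : s <= t <= s + delta ->
  norm (minus (iterate (S n) t) (iterate n t)) <= r * (1 / 2) ^ n.
Proof.
  revert t; induction n as [|n IH]; intros t Ht.
  - simpl pow; rewrite Rmult_1_r.
    exact (admissible_ball _ _ (iterate_admissible 1) Ht).
  - replace (r * (1 / 2) ^ S n) with (r * (1 / 2) ^ n / 2) by (simpl; field).
    apply (picard_contracts (iterate (S n)) (iterate n)); auto using iterate_admissible.
Qed.

(** The limit of the iteration is a fixed point of [picard], hence
    differentiable with the right derivative. *)
Lemma picard_solution : exists x : R -> X, x s = p /\
  forall t, s <= t <= s + delta ->
    norm (minus (x t) p) <= r /\ deriv_from s x t (f t (x t)).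
Proof.
  set (x := fun t => epsilon (inhabits p)
    (fun l => forall n, norm (minus (iterate n t) l) <= 2 * r * (1 / 2) ^ n)).
  assert (Hx : forall t, s <= t <= s + delta -> forall n,
             norm (minus (iterate n t) (x t)) <= 2 * r * (1 / 2) ^ n).
  { intros t Ht; apply (epsilon_spec (inhabits p)
      (fun l => forall n, norm (minus (iterate n t) l) <= 2 * r * (1 / 2) ^ n)).
    apply geometric_limit; intros n; now apply iterate_step. }
  assert (Hadm : admissible x).
  { split.
    - apply eq_of_norm; intros eps He.
      destruct (half_pow_small (2 * r) eps He) as [n Hn].
      specialize (Hx s ltac:(lra) n).
      rewrite (proj1 (iterate_admissible n)), norm_minus_comm in Hx.
      eapply Rle_trans; [exact Hx|exact Hn].
    - intros t u Ht Hu; apply le_epsilon; intros eps He.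
      destruct (half_pow_small (2 * r) (eps / 2)) as [n Hn]; [lra|].
      assert (H1 := Hx t Ht n); assert (H2 := Hx u Hu n).
      assert (H3 := proj2 (iterate_admissible n) t u Ht Hu).
      rewrite norm_minus_comm in H1.
      replace (B * Rabs (t - u) + eps) with (eps / 2 + (B * Rabs (t - u) + eps / 2))
        by field.
      apply (norm_plus_le _ (x t - iterate n t)%V
        ((iterate n t - iterate n u) + (iterate n u - x u))%V); [vec|lra|].
      eapply norm_plus_le; [reflexivity|exact H3|lra]. }
  assert (Hfix : forall t, s <= t <= s + delta -> picard x t = x t).
  { intros t Ht; apply eq_of_norm; intros eps He.
    destruct (half_pow_small (2 * r) (eps / 2)) as [n Hn]; [lra|].
    assert (H1 := picard_contracts (iterate n) x (eps / 2) (iterate_admissible n) Hadm).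
    specialize (H1 ltac:(intros u Hu; eapply Rle_trans; [now apply Hx|exact Hn]) t Ht).
    assert (H2 := Hx t Ht (S n)).
    apply Rle_trans with (eps / 2 / 2 + eps / 2 / 2); [|lra].
    rewrite norm_minus_comm.
    apply (norm_plus_le _ (x t - iterate (S n) t)%V (iterate (S n) t - picard x t)%V).
    - vec.
    - rewrite norm_minus_comm; eapply Rle_trans; [exact H2|]. simpl; lra.
    - exact H1. }
  exists (picard x); split.
  - apply picard_admissible, Hadm.
  - intros t Ht; split.
    + now apply admissible_ball; [apply picard_admissible|].
    + rewrite (Hfix t Ht).
      replace (f t (x t)) with (integrand x t)
        by (unfold integrand; now rewrite clamp_id).
      apply is_derive_deriv_from, picard_derive, Hadm.
Qed.

End Picard.

(** * The flow of a regular field *)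

Lemma Rbar_lt_real (t : R) (b : Rbar) :
  Rbar_lt t b -> exists c : R, t < c /\ Rbar_le c b.
Proof.
  destruct b as [b| |]; simpl; intros H; [exists b|exists (t + 1)|contradiction].
  - split; [exact H|apply Rle_refl].
  - split; [lra|exact I].
Qed.

Section Solutions.

Context {X : CompleteNormedModule R_AbsRing}.
Variables (T : Rbar) (D : X -> Prop) (phi : R -> X -> X) (Dphi : R -> X -> X -> X).
Hypothesis D_open : open D.
Hypothesis regular : regular_field (k := RealScalars) (X := X) T D phi Dphi.

Lemma filterlim_deriv_from s (x : R -> X) t v :
  filterlim (fun u => rscal (k := RealScalars) (X := X) (/ (u - t)) (minus (x u) (x t)))
    (within (fun u => s <= u) (locally' t)) (locally v) <->
  deriv_from s x t v.
Proof.
  split.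
  - intros H eps He.
    destruct (H (fun w => norm (minus w v) < eps)) as [d Hd].
    { apply (locally_of_norm _ _ eps He); auto. }
    exists d; split; [apply cond_pos|]. intros r Hsr Hrt.
    destruct (Req_dec r t) as [->|Hne].
    + apply (norm_le_eq _ zero); [vec|].
      rewrite vnorm_zero; apply Rmult_le_pos; [lra|apply Rabs_pos].
    + assert (Hr : norm (minus (scal (/ (r - t)) (minus (x r) (x t))) v) < eps)
        by exact (Hd r Hrt Hne Hsr).
      apply (norm_le_eq _ ((r - t) *: (/ (r - t) *: (x r - x t) - v))%V).
      { vec_with ltac:(first [ring|field; intros Hc; apply Hne; lra]). }
      eapply Rle_trans; [apply norm_scal_le|].
      rewrite Rmult_comm; apply Rmult_le_compat_r; [apply Rabs_pos|lra].
  - intros H P HP.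
    destruct (norm_of_locally _ _ HP) as [eps [He HeP]].
    destruct (H eps He) as [d [Hd Hr]].
    exists (mkposreal _ Hd); intros r Hrt Hne Hsr.
    change (P (scal (/ (r - t)) (minus (x r) (x t)))).
    assert (Hpos : 0 < Rabs (r - t)) by (apply Rabs_pos_lt; lra).
    apply HeP.
    apply (norm_le_eq _ (/ (r - t) *: (x r - x t - (r - t) *: v))%V).
    { vec_with ltac:(first [ring|field; intros Hc; apply Hne; lra]). }
    eapply Rle_trans; [apply norm_scal_le|].
    rewrite Rabs_inv.
    apply (Rmult_le_reg_l (Rabs (r - t))); [exact Hpos|].
    rewrite <- Rmult_assoc, Rinv_r, Rmult_1_l by lra.
    rewrite (Rmult_comm _ eps); apply (Hr r Hsr Hrt).
Qed.

(** The property [is_solution], with its difference quotients replaced by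
    [deriv_from]. *)
Definition solves (s : R) (p : X) (b : Rbar) (x : R -> X) : Prop :=
  Rbar_lt s b /\ Rbar_le b T /\ x s = p /\
  forall t, s <= t -> Rbar_lt t b -> D (x t) /\ deriv_from s x t (phi t (x t)).

Lemma is_solution_solves s p b x :
  is_solution (k := RealScalars) (X := X) T D phi s p b x <-> solves s p b x.
Proof.
  unfold is_solution, solves; split; intros (H1 & H2 & H3 & H4);
    repeat split; auto; try now apply H4.
  - apply filterlim_deriv_from; now apply H4.
  - apply filterlim_deriv_from; now apply H4.
Qed.

Lemma interior_ball p : D p -> exists r, 0 < r /\ forall x : X, norm (minus x p) <= r -> D x.
Proof. intros Hp; apply norm_of_locally, D_open, Hp. Qed.

Lemma field_continuous_norm t x : time_interval T t -> D x ->
  forall eps, 0 < eps -> exists eta, 0 < eta /\ forall (t' : R) (x' : X),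
    time_interval T t' -> D x' -> Rabs (t' - t) < eta -> norm (minus x' x) < eta ->
    norm (minus (phi t' x') (phi t x)) <= eps.
Proof.
  intros Ht Hx eps He.
  destruct (field_continuous (k := RealScalars) _ _ _ _ regular t x Ht Hx
    (fun w => norm (minus w (phi t x)) < eps)) as [eta Heta].
  { apply (locally_of_norm _ _ eps He); auto. }
  exists eta; split; [apply cond_pos|].
  intros t' x' Ht' Hx' H1 H2; apply Rlt_le, (Heta (t', x')); [|now split].
  split; [exact H1|]. now apply (norm_compat1 (V := X)).
Qed.

(** The derivative of [theta -> phi t (y + theta (x - y))] is bounded by
    [L |x - y|] because a ball is convex. *)
Lemma field_lipschitz p r : (forall x : X, norm (minus x p) <= r -> D x) ->
  exists L, 0 <= L /\ forall (t : R) (x y : X), time_interval T t ->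
    norm (minus x p) <= r -> norm (minus y p) <= r ->
    norm (minus (phi t x) (phi t y)) <= L * norm (minus x y).
Proof.
  intros Hball.
  destruct (field_derivative_bounded (k := RealScalars) _ _ _ _ regular
    (fun x => norm (minus x p) <= r)) as [L0 HL0].
  - assert (Hclosed : forall x : X,
      ~ locally x (fun y : X => ~ norm (minus y p) <= r) -> norm (minus x p) <= r);
      [|exact Hclosed].
    intros x Hx; apply Rnot_lt_le; intros Hlt; apply Hx.
    apply (locally_of_norm _ _ (norm (minus x p) - r)); [lra|].
    intros y Hy Hyr.
    assert (H := norm_plus_le (minus x p) (minus x y) (minus y p) _ _
                   ltac:(vec) (Rle_refl _) Hyr).
    rewrite (norm_minus_comm x y) in H; lra.
  - exists (r + norm p); intros x Hx.
    apply (norm_plus_le _ (x - p)%V p); [vec|exact Hx|apply Rle_refl].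
  - exact Hball.
  - exists (Rmax 0 L0); split; [apply Rmax_l|].
    intros t x y Ht Hx Hy.
    set (w := minus x y).
    assert (Hseg : forall th, 0 <= th <= 1 -> norm (minus (plus y (scal th w)) p) <= r).
    { intros th Hth.
      replace r with (th * r + (1 - th) * r) by ring.
      apply (norm_plus_le _ (th *: (x - p)) ((1 - th) *: (y - p)))%V; [unfold w; vec| |].
      - eapply Rle_trans; [apply norm_scal_le|].
        rewrite Rabs_pos_eq by lra; apply Rmult_le_compat_l; lra.
      - eapply Rle_trans; [apply norm_scal_le|].
        rewrite Rabs_pos_eq by lra; apply Rmult_le_compat_l; lra. }
    assert (H := norm_mean_value 0 1 (fun th => phi t (plus y (scal th w)))
      (fun th => Dphi t (plus y (scal th w)) w) (Rmax 0 L0 * norm w)).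
    replace (Rmax 0 L0 * norm w) with (Rmax 0 L0 * norm w * (1 - 0)) by ring.
    replace x with (plus y (scal 1 w)) by (unfold w; vec).
    replace (phi t y) with (phi t (plus y (scal 0 w))) by (f_equal; unfold w; vec).
    apply H; [lra| |].
    + intros th Hth; apply (filterdiff_along (phi t)).
      apply (field_differentiable (k := RealScalars) _ _ _ _ regular); auto.
    + intros th Hth; eapply Rle_trans.
      { apply (HL0 t (plus y (scal th w)) Ht (Hseg th Hth)). }
      apply Rmult_le_compat_r; [apply norm_ge_0|apply Rmax_r].
Qed.

Lemma time_interval_between s t b :
  time_interval T s -> s <= t -> Rbar_lt t b -> Rbar_le b T -> time_interval T t.
Proof.
  intros [Hs _] Hst Htb HbT; split; [lra|].
  now apply Rbar_lt_le_trans with b.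
Qed.

Lemma local_existence s p : time_interval T s -> D p ->
  exists (b : R) x, s < b /\ solves s p b x.
Proof.
  intros Hs Hp.
  destruct (interior_ball p Hp) as [r [Hr Hball]].
  destruct (field_lipschitz p r Hball) as [L [HL Hlip]].
  destruct (field_continuous_norm s p Hs Hp 1 Rlt_0_1) as [eta [Heta Hcont]].
  destruct (Rbar_lt_real s T (proj2 Hs)) as [c [Hsc HcT]].
  assert (Hp0 : norm (minus p p) = 0) by apply norm_minus_diag.
  (* On the ball, [L r] bounds the distance of the field to its value at the
     centre, and continuity at [(s,p)] with tolerance 1 bounds that value. *)
  set (B := norm (phi s p) + 1 + L * r).
  assert (HB : 0 < B).
  { assert (H := norm_ge_0 (phi s p)). unfold B; nra. }
  set (delta := Rmin (Rmin (eta / 2) ((c - s) / 2)) (Rmin (r / B) (1 / (2 * (L + 1))))).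
  assert (Hdelta : 0 < delta /\ delta < eta /\ s + delta < c /\ B * delta <= r
                   /\ L * delta <= 1 / 2).
  { assert (H1 := Rmin_l (Rmin (eta / 2) ((c - s) / 2)) (Rmin (r / B) (1 / (2 * (L + 1))))).
    assert (H2 := Rmin_r (Rmin (eta / 2) ((c - s) / 2)) (Rmin (r / B) (1 / (2 * (L + 1))))).
    assert (H3 := Rmin_l (eta / 2) ((c - s) / 2)).
    assert (H4 := Rmin_r (eta / 2) ((c - s) / 2)).
    assert (H5 := Rmin_l (r / B) (1 / (2 * (L + 1)))).
    assert (H6 := Rmin_r (r / B) (1 / (2 * (L + 1)))).
    fold delta in H1, H2.
    assert (H0 : 0 < delta).
    { unfold delta; repeat apply Rmin_pos; try lra.
      - now apply Rdiv_lt_0_compat.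
      - apply Rdiv_lt_0_compat; lra. }
    repeat split; try lra.
    - assert (H7 : delta <= r / B) by lra. apply Rle_div_r in H7; [lra|exact HB].
    - assert (H7 : delta <= 1 / (2 * (L + 1))) by lra.
      apply Rle_div_r in H7; [|lra]. nra. }
  destruct Hdelta as (Hd0 & Hd1 & Hd2 & Hd3 & Hd4).
  assert (HJ : forall t, s <= t <= s + delta -> time_interval T t).
  { intros t Ht; split; [destruct Hs; lra|].
    apply Rbar_lt_le_trans with c; [simpl; lra|exact HcT]. }
  destruct (picard_solution phi s delta r B L p) as [x [Hxs Hx]]; auto; try lra.
  - intros t x Ht Hx.
    replace B with (L * r + (1 + norm (phi s p))) by (unfold B; ring).
    apply (norm_plus_le _ (phi t x - phi t p)%V ((phi t p - phi s p) + phi s p)%V); [vec| |].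
    + eapply Rle_trans; [apply Hlip; auto; rewrite Hp0; lra|].
      apply Rmult_le_compat_l; auto.
    + eapply norm_plus_le; [reflexivity| |apply Rle_refl].
      apply Hcont; auto; [rewrite Rabs_pos_eq; lra|rewrite Hp0; lra].
  - intros t x Ht Hx eps He.
    destruct (field_continuous_norm t x (HJ t Ht) (Hball x Hx) eps He) as [z [Hz Hc]].
    exists z; split; auto.
  - exists (s + delta), x; split; [lra|]. split; [simpl; lra|]. split.
    + apply Rbar_le_trans with c; [simpl; lra|exact HcT].
    + split; auto; intros t Hst Ht; simpl in Ht.
      destruct (Hx t ltac:(lra)) as [H1 H2]; split; auto.
Qed.

(** On a short interval after a time where two solutions agree, a bound [M] on
    their distance improves to [M/2]. *)
Lemma solution_unique s p b b' x y :
  time_interval T s -> solves s p b x -> solves s p b' y ->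
  forall t, s <= t -> Rbar_lt t b -> Rbar_lt t b' -> x t = y t.
Proof.
  intros HJs (Hsb & HbT & Hxs & Hx) (Hsb' & _ & Hys & Hy) t1 Hst1 Hb Hb'.
  assert (HX : forall t, s <= t <= t1 -> D (x t) /\ deriv_from s x t (phi t (x t))).
  { intros t Ht; apply Hx; [lra|]. apply Rbar_le_lt_trans with t1; simpl; auto; lra. }
  assert (HY : forall t, s <= t <= t1 -> D (y t) /\ deriv_from s y t (phi t (y t))).
  { intros t Ht; apply Hy; [lra|]. apply Rbar_le_lt_trans with t1; simpl; auto; lra. }
  assert (HJ : forall t, s <= t <= t1 -> time_interval T t).
  { intros t Ht; apply (time_interval_between s t b); auto; [lra|].
    apply Rbar_le_lt_trans with t1; simpl; auto; lra. }
  apply (real_induction s t1 (fun t => x t = y t)); [congruence| | |lra].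
  - intros t Ht IH; apply eq_of_norm; intros eps He.
    destruct (deriv_from_continuous _ _ _ _ (proj2 (HX t ltac:(lra))) (eps / 2))
      as [d [Hd Hc]]; [lra|].
    destruct (deriv_from_continuous _ _ _ _ (proj2 (HY t ltac:(lra))) (eps / 2))
      as [d' [Hd' Hc']]; [lra|].
    set (u := Rmax s (t - Rmin d d' / 2)).
    assert (Hm := Rmin_pos d d' Hd Hd').
    assert (Hm1 := Rmin_l d d'); assert (Hm2 := Rmin_r d d').
    assert (Hu : s <= u < t /\ t - u < Rmin d d').
    { unfold u; apply Rmax_case_strong; lra. }
    assert (Hut : Rabs (u - t) < Rmin d d') by (apply Rabs_def1; lra).
    replace eps with (eps / 2 + eps / 2) by field.
    apply (norm_plus_le _ (x t - x u)%V (y u - y t)%V).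
    + rewrite (IH u) by lra; vec.
    + rewrite norm_minus_comm; apply Hc; lra.
    + apply Hc'; lra.
  - intros t Ht Heq.
    destruct (interior_ball (x t) (proj1 (HX t ltac:(lra)))) as [r [Hr Hball]].
    destruct (field_lipschitz _ r Hball) as [L [HL Hlip]].
    destruct (deriv_from_continuous _ _ _ _ (proj2 (HX t ltac:(lra))) r Hr)
      as [d [Hd Hc]].
    destruct (deriv_from_continuous _ _ _ _ (proj2 (HY t ltac:(lra))) r Hr)
      as [d' [Hd' Hc']].
    rewrite <- Heq in Hc'.
    set (dd := Rmin (Rmin d d') (1 / (2 * (L + 1)))).
    assert (Hl : 0 < 1 / (2 * (L + 1))) by (apply Rdiv_lt_0_compat; lra).
    assert (H1 := Rmin_l (Rmin d d') (1 / (2 * (L + 1)))).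
    assert (H2 := Rmin_r (Rmin d d') (1 / (2 * (L + 1)))).
    assert (H3 := Rmin_l d d'); assert (H4 := Rmin_r d d').
    fold dd in H1, H2.
    exists dd; split; [now repeat apply Rmin_pos|].
    intros u Hu Hut1.
    assert (HLd : L * (u - t) <= 1 / 2).
    { assert (H5 : u - t <= 1 / (2 * (L + 1))) by lra.
      apply Rle_div_r in H5; [|lra]. nra. }
    assert (Hxr : forall v, t <= v <= u -> norm (minus (x v) (x t)) <= r).
    { intros v Hv; apply Hc; [lra|]. apply Rabs_def1; lra. }
    assert (Hyr : forall v, t <= v <= u -> norm (minus (y v) (x t)) <= r).
    { intros v Hv; apply Hc'; [lra|]. apply Rabs_def1; lra. }
    assert (Hhalf : forall n v, t <= v <= u ->
              norm (minus (x v) (y v)) <= 2 * r * (1 / 2) ^ n).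
    { induction n as [|n IH]; intros v Hv.
      - simpl; replace (2 * r * 1) with (r + r) by ring.
        apply (norm_plus_le _ (x v - x t)%V (x t - y v)%V); [vec|auto|].
        rewrite norm_minus_comm; auto.
      - assert (Hmv := norm_mean_value t v (fun a => minus (x a) (y a))
          (fun a => minus (phi a (x a)) (phi a (y a))) (L * (2 * r * (1 / 2) ^ n))).
        apply (norm_le_eq _ ((x v - y v) - (x t - y t))%V).
        { rewrite Heq; vec. }
        eapply Rle_trans; [apply Hmv; [lra| |]|].
        + intros a Ha; apply deriv_from_minus.
          * apply (deriv_from_weaken s); [lra|apply HX; lra].
          * apply (deriv_from_weaken s); [lra|apply HY; lra].
        + intros a Ha; eapply Rle_trans.
          { apply Hlip; [apply HJ; lra|apply Hxr; lra|apply Hyr; lra]. }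
          apply Rmult_le_compat_l; [auto|apply IH; lra].
        + assert (Hp : 0 < (1 / 2) ^ n) by (apply pow_lt; lra).
          simpl pow.
          assert (Hr0 : 0 < 2 * r * (1 / 2) ^ n) by (apply Rmult_lt_0_compat; lra).
          assert (Hvu : L * (v - t) <= 1 / 2) by nra.
          nra. }
    apply eq_of_norm; intros eps He.
    destruct (half_pow_small (2 * r) eps He) as [n Hn].
    eapply Rle_trans; [apply (Hhalf n); lra|exact Hn].
Qed.

(** By uniqueness all solutions from [(s,p)] can be glued together; the life
    time is the supremum of their end points. *)
Lemma maximal_solution_exists s p : time_interval T s -> D p ->
  exists a x, solves s p a x /\ forall b y, solves s p b y -> Rbar_le b a.
Proof.
  intros Hs Hp.
  set (E := fun b : Rbar => exists y, solves s p b y).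
  destruct (Rbar_ex_lub E) as [a [Hub Hlub]].
  set (good := fun (t : R) (y : R -> X) => exists b, solves s p b y /\ Rbar_lt t b).
  set (x := fun t => epsilon (inhabits (fun _ : R => p)) (good t) t).
  assert (Hx : forall b y, solves s p b y -> forall t, s <= t -> Rbar_lt t b -> x t = y t).
  { intros b y Hy t Hst Htb.
    assert (Hg : good t (epsilon (inhabits (fun _ : R => p)) (good t))).
    { apply epsilon_spec; exists y, b; auto. }
    destruct Hg as [b' [Hsol Htb']].
    exact (solution_unique s p b' b _ y Hs Hsol Hy t Hst Htb' Htb). }
  destruct (local_existence s p Hs Hp) as [b0 [y0 [Hb0 Hy0]]].
  assert (Hreach : forall t, Rbar_lt t a -> exists b y, solves s p b y /\ Rbar_lt t b).
  { intros t Ht; apply NNPP; intros Hno; apply (Rbar_lt_not_le _ _ Ht), Hlub.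
    intros b [y Hy]; apply Rbar_not_lt_le; intros Hlt; apply Hno; now exists b, y. }
  exists a, x; split; [|intros b y Hy; apply Hub; now exists y].
  repeat split.
  - apply Rbar_lt_le_trans with b0; [exact Hb0|apply Hub; now exists y0].
  - apply Hlub; intros b [y Hy]; apply Hy.
  - rewrite (Hx b0 y0 Hy0 s) by (simpl; auto; lra). apply Hy0.
  - destruct (Hreach t H0) as (b & y & Hy & Htb).
    rewrite (Hx b y Hy t H Htb); now apply Hy.
  - destruct (Hreach t H0) as (b & y & Hy & Htb).
    rewrite (Hx b y Hy t H Htb).
    destruct (Rbar_lt_real t b Htb) as [c [Htc Hcb]].
    apply (deriv_from_ext s y x t _ c); auto.
    + intros r Hr; symmetry; apply (Hx b y Hy); [lra|].
      apply Rbar_lt_le_trans with c; simpl; auto; lra.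
    + now apply Hy.
Qed.

Notation flow_of s p := (fun t => flow (k := RealScalars) (X := X) T D phi s t p).
Notation life s p := (life_time (k := RealScalars) (X := X) T D phi s p).
Notation exit s p := (exit_time (k := RealScalars) (X := X) T D phi D s p).

(** The chosen [maximal_solution] is a solution, because a maximal one exists; by
    uniqueness every other solution agrees with it and ends no later. *)
Lemma flow_maximal s p : time_interval T s -> D p ->
  solves s p (life s p) (flow_of s p) /\
  forall b y, solves s p b y -> Rbar_le b (life s p).
Proof.
  intros Hs Hp.
  destruct (maximal_solution_exists s p Hs Hp) as (a & x & Hsol & Hmax).
  assert (H : is_maximal_solution (k := RealScalars) (X := X) T D phi s p
                (life s p) (flow_of s p)).
  { apply (epsilon_spec (inhabits (Finite s, fun _ : R => p))
      (fun q => is_maximal_solution (k := RealScalars) (X := X) T D phi s p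
                  (fst q) (snd q))).
    exists (a, x); simpl; split.
    - now apply is_solution_solves.
    - intros b y Hy _; apply (Hmax b y); now apply is_solution_solves. }
  destruct H as [Hflow Hext]; apply is_solution_solves in Hflow.
  split; auto; intros b y Hy; apply (Hext b y).
  - now apply is_solution_solves.
  - intros t Hst Hta Htb; now apply (solution_unique s p b (life s p)).
Qed.

(** A solution in [D] cannot leave [D] during its life, so the exit time from [D]
    is the life time; the two inequalities are [exit_life] and [life_exit]. *)
Lemma exit_life s p t : s <= t -> Rbar_lt t (exit s p) -> Rbar_lt t (life s p).
Proof.
  intros Hst Ht; destruct (Lub_Rbar_correct (fun b => s < b /\ Rbar_lt b (life s p) /\
    forall t, s <= t < b -> D (flow_of s p t))) as [_ Hlub].
  apply Rbar_lt_le_trans with (1 := Ht), Hlub.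
  intros b (_ & Hb & _); now apply Rbar_lt_le.
Qed.

Lemma life_exit s p t : time_interval T s -> D p -> s <= t ->
  Rbar_lt t (life s p) -> Rbar_lt t (exit s p).
Proof.
  intros Hs Hp Hst Ht.
  destruct (flow_maximal s p Hs Hp) as [Hflow _].
  destruct (Rbar_lt_real t _ Ht) as [c [Htc Hc]].
  set (b := (t + c) / 2).
  assert (Hb : Rbar_lt b (life s p)).
  { apply Rbar_lt_le_trans with c; [unfold b; simpl; lra|auto]. }
  destruct (Lub_Rbar_correct (fun b => s < b /\ Rbar_lt b (life s p) /\
    forall t, s <= t < b -> D (flow_of s p t))) as [Hub _].
  apply Rbar_lt_le_trans with b; [unfold b; simpl; lra|].
  apply Hub; split; [unfold b; lra|]. split; auto.
  intros r Hr; apply Hflow; [lra|].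
  apply Rbar_lt_trans with b; [simpl; lra|auto].
Qed.

(** The differential equation at the starting time, in a form that compares two
    flows over the same short time. *)
Lemma flow_expansion s p : time_interval T s -> D p ->
  forall eps, 0 < eps -> exists delta, 0 < delta /\ forall h, 0 <= h < delta ->
    Rbar_lt (s + h) (exit s p) /\
    norm (minus (flow_of s p (s + h)) (plus p (scal h (phi s p)))) <= eps * h.
Proof.
  intros Hs Hp eps He.
  destruct (flow_maximal s p Hs Hp) as [Hflow _].
  assert (Hf := Hflow); destruct Hf as (Hlife & _ & Hstart & Hder).
  destruct (Hder s (Rle_refl s) Hlife) as [_ Hd].
  rewrite Hstart in Hd.
  destruct (Hd eps He) as [d [Hd0 Hd1]].
  destruct (Rbar_lt_real s _ Hlife) as [c [Hsc Hc]].
  exists (Rmin d (c - s)); split; [apply Rmin_pos; lra|].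
  intros h Hh.
  assert (H1 := Rmin_l d (c - s)); assert (H2 := Rmin_r d (c - s)).
  split.
  - apply life_exit; auto; [lra|].
    apply Rbar_lt_le_trans with c; [simpl; lra|auto].
  - specialize (Hd1 (s + h) ltac:(lra)).
    replace (s + h - s) with h in Hd1 by ring.
    rewrite Rabs_pos_eq in Hd1 by lra.
    eapply norm_le_eq; [|apply Hd1; lra]. rewrite Hstart; vec.
Qed.

End Solutions.

(** * Cones and the Thompson metric *)

Lemma ln_nonpos m : m <= 0 -> ln m = 0.
Proof.
  intros Hm; unfold ln; destruct (Rlt_dec 0 m) as [H|H]; [|reflexivity].
  exfalso; exact (Rlt_irrefl _ (Rlt_le_trans _ _ _ H Hm)).
Qed.

Section ConeFacts.

Context {X : CompleteNormedModule R_AbsRing}.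
Implicit Types (u v w z e : X).
Variable C : X -> Prop.
Hypothesis cone : closed_pointed_cone (k := RealScalars) (X := X) C.

Lemma cone_eq u v : C u -> u = v -> C v.
Proof. now intros H <-. Qed.

Lemma cone_scale (a : R) u : 0 <= a -> C u -> C (scal a u).
Proof. apply (cone_scal (k := RealScalars) _ cone). Qed.

Lemma cone_add u v : C u -> C v -> C (plus u v).
Proof. apply (cone_plus (k := RealScalars) _ cone). Qed.

Lemma interior_in_cone e : cone_interior (k := RealScalars) (X := X) C e -> C e.
Proof.
  intros H; destruct (norm_of_locally _ _ H) as [eps [He Hn]].
  apply Hn; rewrite norm_minus_diag; lra.
Qed.

(** An interior point [e] is an order unit: it absorbs any vector at a cost
    proportional to its norm. *)
Lemma order_unit e : cone_interior (k := RealScalars) (X := X) C e ->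
  exists kappa, 0 < kappa /\ forall (w : X) (c : R), norm w <= c ->
    C (plus (scal (kappa * c) e) w).
Proof.
  intros H; assert (He0 := interior_in_cone e H).
  destruct (norm_of_locally _ _ H) as [eps [He Hn]].
  exists (/ eps); split; [now apply Rinv_0_lt_compat|].
  intros w c Hwc.
  destruct (Rle_lt_dec c 0) as [Hc|Hc].
  - assert (Hw0 := norm_ge_0 w).
    replace c with 0 by lra.
    assert (Hw : w = zero) by (apply (norm_eq_zero w); lra).
    rewrite Hw.
    apply (cone_eq (scal 0 e)); [apply cone_scale; auto; lra|vec].
  - apply (cone_eq (scal (c / eps) (plus e (scal (eps / c) w)))).
    + apply cone_scale; [apply Rlt_le, Rdiv_lt_0_compat; auto|].
      apply Hn; apply (norm_le_eq _ (scal (eps / c) w)); [vec|].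
      assert (Hec : 0 < eps / c) by now apply Rdiv_lt_0_compat.
      eapply Rle_trans; [apply norm_scal_le|].
      rewrite Rabs_pos_eq by lra.
      apply Rle_trans with (eps / c * c); [apply Rmult_le_compat_l; lra|].
      apply Req_le; field; lra.
    + vec.
Qed.

(** As an order unit, zero absorbs every vector at no cost. *)
Lemma cone_full w : cone_interior (k := RealScalars) (X := X) C zero -> C w.
Proof.
  intros H; destruct (order_unit _ H) as [kappa [_ Hk]].
  eapply cone_eq; [apply (Hk w (norm w)); apply Rle_refl|vec].
Qed.

Lemma opp_interior_not_in_cone u : cone_interior (k := RealScalars) (X := X) C u ->
  ~ cone_interior (k := RealScalars) (X := X) C zero -> ~ C (opp u).
Proof.
  intros Hu H0 Hopp; apply H0.
  rewrite <- (cone_pointed (k := RealScalars) _ cone u (interior_in_cone u Hu) Hopp).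
  exact Hu.
Qed.

(** The difference quotients of [g] at [s] lie in the cone, which is closed. *)
Lemma cone_derivative s (g : R -> X) v delta :
  deriv_from s g s v -> g s = zero -> 0 < delta ->
  (forall h, 0 <= h < delta -> C (g (s + h))) -> C v.
Proof.
  intros Hg Hgs Hdelta HC.
  apply (closed_approx C); [apply (cone_closed (k := RealScalars) _ cone)|].
  intros eps He; destruct (Hg eps He) as [d [Hd Hr]].
  set (h := Rmin d delta / 2).
  assert (Hm := Rmin_pos d delta Hd Hdelta).
  assert (H1 := Rmin_l d delta); assert (H2 := Rmin_r d delta).
  assert (Hh : 0 < h) by (unfold h; lra).
  exists (scal (/ h) (g (s + h))); split.
  - specialize (Hr (s + h) ltac:(lra)).
    replace (s + h - s) with h in Hr by ring.
    rewrite Rabs_pos_eq in Hr by lra.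
    specialize (Hr ltac:(unfold h; lra)).
    apply (norm_le_eq _ (scal (/ h) (g (s + h)%R - g s - h *: v)%V)); [rewrite Hgs; vec|].
    eapply Rle_trans; [apply norm_scal_le|].
    rewrite Rabs_pos_eq by (apply Rlt_le, Rinv_0_lt_compat; lra).
    apply (Rmult_le_reg_l h); [lra|].
    rewrite <- Rmult_assoc, Rinv_r, Rmult_1_l by lra; lra.
  - apply cone_scale; [apply Rlt_le, Rinv_0_lt_compat; lra|].
    apply HC; unfold h; lra.
Qed.

Lemma cone_left_limit (a t : R) (x : R -> X) v :
  a < t -> deriv_from a x t v -> (forall r, a <= r < t -> C (x r)) -> C (x t).
Proof.
  intros Hat Hx HC.
  apply (closed_approx C); [apply (cone_closed (k := RealScalars) _ cone)|].
  intros eps He.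
  destruct (deriv_from_continuous _ _ _ _ Hx eps He) as [d [Hd Hc]].
  set (r := Rmax a (t - d / 2)).
  assert (Hr : a <= r < t /\ t - r < d) by (unfold r; apply Rmax_case_strong; lra).
  exists (x r); split; [|apply HC; lra].
  apply Hc; [lra|]. apply Rabs_def1; lra.
Qed.

(** Mean value theorem for the order: the error term [eps (t - a) e] absorbs the
    [o(h)] of the derivative. *)
Lemma cone_mean_value e (a b : R) (x dx : R -> X) :
  cone_interior (k := RealScalars) (X := X) C e -> a <= b ->
  (forall t, a <= t <= b -> deriv_from a x t (dx t)) ->
  (forall t, a <= t <= b -> C (dx t)) ->
  C (minus (x b) (x a)).
Proof.
  intros He Hab Hd HC.
  destruct (order_unit e He) as [kappa [Hk Hunit]].
  assert (H : forall eps, 0 < eps -> forall t, a <= t <= b ->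
    C (plus (minus (x t) (x a)) (scal (eps * (t - a)) e))).
  { intros eps Heps.
    assert (Hde : forall t, a <= t <= b -> deriv_from a
      (fun t => plus (minus (x t) (x a)) (scal (eps * (t - a)) e)) t
      (plus (minus (dx t) zero) (plus (scal eps e) (scal (eps * (t - a)) zero)))).
    { intros t Ht; apply deriv_from_plus.
      - apply deriv_from_minus; [auto|apply deriv_from_const].
      - apply (deriv_from_scal a (fun t => eps * (t - a)) eps (fun _ => e)).
        + auto_derive; [auto|ring].
        + apply deriv_from_const. }
    apply real_induction.
    - apply (cone_eq zero); [apply (cone_zero (k := RealScalars) _ cone)|vec].
    - intros t Ht IH.
      eapply (cone_left_limit a t
        (fun t => plus (minus (x t) (x a)) (scal (eps * (t - a)) e))); [lra| |exact IH].
      apply Hde; lra.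
    - intros t Ht IH.
      destruct (Hd t ltac:(lra) (eps / kappa)) as [d [Hd0 Hr]].
      { now apply Rdiv_lt_0_compat. }
      exists d; split; auto; intros u Hu Hub.
      specialize (Hr u ltac:(lra)); rewrite Rabs_pos_eq in Hr by lra.
      specialize (Hr ltac:(lra)).
      eapply cone_eq.
      { apply cone_add; [exact IH|].
        apply cone_add; [apply (cone_scale (u - t)); [lra|apply (HC t); lra]|].
        exact (Hunit _ _ Hr). }
      vec. }
  apply (closed_approx C); [apply (cone_closed (k := RealScalars) _ cone)|].
  intros eps Heps.
  set (q := eps / ((b - a) * norm e + 1)).
  assert (Hn : 0 <= (b - a) * norm e) by (apply Rmult_le_pos; [lra|apply norm_ge_0]).
  assert (Hq : 0 < q) by (apply Rdiv_lt_0_compat; lra).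
  eexists; split; [|apply (H q Hq b); lra].
  apply (norm_le_eq _ (scal (q * (b - a)) e)); [vec|].
  eapply Rle_trans; [apply norm_scal_le|].
  rewrite Rabs_pos_eq by (apply Rmult_le_pos; lra).
  replace eps with (q * ((b - a) * norm e + 1)) by (unfold q; field; lra).
  rewrite Rmult_assoc; apply Rmult_le_compat_l; lra.
Qed.

(** The infimum is attained because the cone is closed. *)
Lemma thompson_M_le w v (m : R) : C v ->
  Rbar_le (thompson_M (k := RealScalars) (X := X) C w v) m <-> C (minus (scal m v) w).
Proof.
  intros Hv.
  assert (HG : is_glb_Rbar (fun t => C (minus (scal t v) w))
                 (thompson_M (k := RealScalars) (X := X) C w v))
    by exact (Glb_Rbar_correct _).
  destruct HG as [Hlb Hglb].
  split; [|apply Hlb].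
  intros Hm.
  apply (closed_approx C); [apply (cone_closed (k := RealScalars) _ cone)|].
  intros eps He.
  assert (Hn := norm_ge_0 v).
  assert (Hq : 0 < eps / (norm v + 1)) by (apply Rdiv_lt_0_compat; lra).
  exists (minus (scal (m + eps / (norm v + 1)) v) w); split.
  - apply (norm_le_eq _ (scal (eps / (norm v + 1)) v)); [vec|].
    eapply Rle_trans; [apply norm_scal_le|].
    rewrite Rabs_pos_eq by lra.
    replace eps with (eps / (norm v + 1) * (norm v + 1)) at 2 by (field; lra).
    apply Rmult_le_compat_l; lra.
  - assert (Ht : exists t, t < m + eps / (norm v + 1) /\ C (minus (scal t v) w)).
    { apply NNPP; intros Hno.
      assert (H : Rbar_le (m + eps / (norm v + 1)) m); [|simpl in H; lra].
      apply Rbar_le_trans with (2 := Hm), Hglb.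
      intros t Ht; apply Rnot_lt_le; intros Hlt; apply Hno; now exists t. }
    destruct Ht as [t [Ht HC]].
    apply (cone_eq (plus (minus (scal t v) w) (scal (m + eps / (norm v + 1) - t) v))).
    + apply cone_add; [exact HC|apply cone_scale; [lra|exact Hv]].
    + vec.
Qed.

(** Both [real m_infty] and [ln] of a nonpositive number are 0, so the bound also
    holds in the degenerate cases. *)
Lemma thompson_dist_le u v r : C u -> C v -> 0 <= r ->
  C (minus (scal (exp r) v) u) -> C (minus (scal (exp r) u) v) ->
  thompson_dist (k := RealScalars) (X := X) C u v <= r.
Proof.
  intros Hu Hv Hr Huv Hvu.
  assert (Hreal : forall w z, C z -> C (minus (scal (exp r) z) w) ->
            real (thompson_M (k := RealScalars) (X := X) C w z) <= exp r).
  { intros w z Hz Hwz; apply thompson_M_le in Hwz; auto.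
    assert (He := exp_pos r).
    destruct (thompson_M (k := RealScalars) C w z); simpl in *; [auto|contradiction|lra]. }
  unfold thompson_dist.
  assert (Hmax := Rmax_lub _ _ _ (Hreal u v Hv Huv) (Hreal v u Hu Hvu)).
  set (m := Rmax _ _) in *.
  destruct (Rlt_le_dec 0 m) as [Hm|Hm].
  - rewrite <- (ln_exp r).
    destruct Hmax as [Hlt| ->]; [|apply Rle_refl].
    now apply Rlt_le, ln_increasing.
  - now rewrite ln_nonpos.
Qed.

(** Unless the space is trivial, [m1 = M(u/v)] and [m2 = M(v/u)] satisfy
    [u <= m1 m2 u], hence [m1 m2 >= 1] because [- u] is outside of the cone; so the
    larger one is at least 1. *)
Lemma thompson_dist_spec u v :
  cone_interior (k := RealScalars) (X := X) C u ->
  cone_interior (k := RealScalars) (X := X) C v ->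
  let d := thompson_dist (k := RealScalars) (X := X) C u v in
  0 <= d /\ C (minus (scal (exp d) v) u) /\ C (minus (scal (exp d) u) v).
Proof.
  intros Hu Hv d.
  assert (Cu := interior_in_cone u Hu); assert (Cv := interior_in_cone v Hv).
  destruct (classic (cone_interior (k := RealScalars) (X := X) C zero)) as [H0|H0].
  - split; [|split; now apply cone_full].
    assert (HM : forall w z, C z ->
              thompson_M (k := RealScalars) (X := X) C w z = m_infty).
    { intros w z Hz.
      assert (H : forall m : R, Rbar_le (thompson_M (k := RealScalars) (X := X) C w z) m).
      { intros m; apply thompson_M_le; [auto|now apply cone_full]. }
      destruct (thompson_M (k := RealScalars) C w z) as [m| |]; auto.
      - specialize (H (m - 1)); simpl in H; lra.
      - contradiction (H 0). }
    unfold d, thompson_dist; rewrite !HM by auto; simpl.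
    rewrite Rmax_left by lra.
    rewrite ln_nonpos; apply Rle_refl.
  - assert (HM : forall w z, cone_interior (k := RealScalars) (X := X) C w ->
              cone_interior (k := RealScalars) (X := X) C z ->
              exists m, thompson_M (k := RealScalars) (X := X) C w z = Finite m /\
                0 < m /\ C (minus (scal m z) w)).
    { intros w z Hw Hz.
      assert (Cz := interior_in_cone z Hz); assert (Cw := interior_in_cone w Hw).
      assert (Hpos : forall t, C (minus (scal t z) w) -> 0 < t).
      { intros t Ht; apply Rnot_le_lt; intros Hle.
        apply (opp_interior_not_in_cone w Hw H0).
        apply (cone_eq (plus (minus (scal t z) w) (scal (- t) z))); [|vec].
        apply cone_add; [auto|apply cone_scale; [lra|auto]]. }
      assert (Hle := fun m => thompson_M_le w z m Cz).
      destruct (thompson_M (k := RealScalars) C w z) as [m| |].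
      - exists m; assert (Hm : C (minus (scal m z) w)) by (apply Hle, Rle_refl).
        auto.
      - destruct (order_unit z Hz) as [kappa [_ Hk]].
        exfalso; apply (Hle (kappa * norm (opp w))).
        apply (cone_eq (plus (scal (kappa * norm (opp w)) z) (opp w))); [|vec].
        apply Hk, Rle_refl.
      - assert (H1 : 0 < 0); [|lra].
        apply Hpos, Hle; exact I. }
    destruct (HM u v Hu Hv) as [m1 [E1 [Hm1 H1]]].
    destruct (HM v u Hv Hu) as [m2 [E2 [Hm2 H2]]].
    unfold d, thompson_dist; rewrite E1, E2; simpl real.
    assert (Hl := Rmax_l m1 m2); assert (Hr := Rmax_r m1 m2).
    assert (Hmm : 1 <= m1 * m2).
    { apply Rnot_lt_le; intros Hlt.
      apply (opp_interior_not_in_cone u Hu H0).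
      apply (cone_eq (scal (/ (1 - m1 * m2))
        (plus (minus (scal m1 v) u) (scal m1 (minus (scal m2 u) v))))).
      - apply cone_scale; [apply Rlt_le, Rinv_0_lt_compat; lra|].
        apply cone_add; [auto|apply cone_scale; [lra|auto]].
      - vec. }
    assert (Hmax : 1 <= Rmax m1 m2).
    { apply Rnot_lt_le; intros Hlt. nra. }
    rewrite exp_ln by lra.
    split; [|split].
    + rewrite <- ln_1; destruct Hmax as [Hlt| <-]; [|apply Rle_refl].
      apply Rlt_le, ln_increasing; lra.
    + apply (cone_eq (plus (minus (scal m1 v) u) (scal (Rmax m1 m2 - m1) v))); [|vec].
      apply cone_add; [auto|apply cone_scale; [lra|auto]].
    + apply (cone_eq (plus (minus (scal m2 u) v) (scal (Rmax m1 m2 - m2) u))); [|vec].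
      apply cone_add; [auto|apply cone_scale; [lra|auto]].
Qed.

End ConeFacts.

(** * Order-preserving flows and differential inequalities *)

Section OrderPreserving.

Context {X : CompleteNormedModule R_AbsRing}.
Implicit Types (p q u v w e : X).
Variable C : X -> Prop.
Hypothesis cone : closed_pointed_cone (k := RealScalars) (X := X) C.
Variable e0 : X.
Hypothesis e0_interior : cone_interior (k := RealScalars) (X := X) C e0.
Variables (T : Rbar) (U : X -> Prop) (phi : R -> X -> X) (Dphi : R -> X -> X -> X).
Hypothesis U_open : open U.
Hypothesis regular : regular_field (k := RealScalars) (X := X) T U phi Dphi.

Notation flow_of s p := (fun t => flow (k := RealScalars) (X := X) T U phi s t p).

Hypothesis mono : order_preserving (k := RealScalars) (X := X) C T U phi U.

(** Over a short time both flows are their first order expansions up to errors of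
    size [h eps / (2 kappa)], which [(eps h) e] absorbs. *)
Lemma quasimonotone s p q e : time_interval T s -> U p -> U q -> C (minus q p) ->
  cone_interior (k := RealScalars) (X := X) C e ->
  forall eps, 0 < eps -> exists delta, 0 < delta /\ forall h, 0 <= h < delta ->
    C (plus (minus (plus q (scal h (phi s q))) (plus p (scal h (phi s p))))
            (scal (eps * h) e)).
Proof.
  intros Hs Hp Hq Hpq He eps Heps.
  destruct (order_unit C cone e He) as [kappa [Hk Hunit]].
  assert (Hz : 0 < eps / (2 * kappa)) by (apply Rdiv_lt_0_compat; lra).
  destruct (flow_expansion T U phi Dphi U_open regular s p Hs Hp _ Hz) as [d [Hd Hfp]].
  destruct (flow_expansion T U phi Dphi U_open regular s q Hs Hq _ Hz) as [d' [Hd' Hfq]].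
  exists (Rmin d d'); split; [now apply Rmin_pos|].
  intros h Hh.
  assert (H1 := Rmin_l d d'); assert (H2 := Rmin_r d d').
  destruct (Hfp h ltac:(lra)) as [Ep Np]; destruct (Hfq h ltac:(lra)) as [Eq Nq].
  rewrite norm_minus_comm in Nq.
  assert (Hflow : C (minus (flow_of s q (s + h)) (flow_of s p (s + h)))).
  { apply (mono q p); auto; [lra|].
    apply Rbar_min_case; auto. }
  cbv beta in Hflow, Np, Nq.
  eapply (cone_eq C).
  { apply (cone_add C cone); [exact Hflow|].
    apply (cone_add C cone); [apply (Hunit _ _ Np)|apply (Hunit _ _ Nq)]. }
  vec.
Qed.

(** Near a common time [s0] the curve [y] stays below [x + eps g e] with [g]
    growing linearly.  At a time where the inequality holds, quasimonotonicity
    compares the field at [y] with the field at [x + eps g e], and the Lipschitz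
    constant [L] compares the latter with the field at [x]: the growth rate [K]
    of [g] is made to exceed the loss [kappa L |e| g], where [g <= 2]. *)
Lemma comparison_local s0 t1 (x y dy : R -> X) :
  s0 < t1 ->
  (forall t, s0 <= t <= t1 -> time_interval T t /\ U (x t) /\ U (y t) /\
     deriv_from s0 x t (phi t (x t)) /\ deriv_from s0 y t (dy t) /\
     C (minus (phi t (y t)) (dy t))) ->
  C (minus (x s0) (y s0)) ->
  exists delta, 0 < delta /\ forall t, s0 <= t < s0 + delta -> t <= t1 ->
    C (minus (x t) (y t)).
Proof.
  intros Hs0t1 Hxy Hinit.
  set (e := e0).
  destruct (order_unit C cone e e0_interior) as [kappa [Hk Hunit]].
  destruct (Hxy s0 ltac:(lra)) as (_ & Hx0 & _ & Hdx0 & _).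
  destruct (interior_ball U U_open (x s0) Hx0) as [r [Hr Hball]].
  destruct (field_lipschitz T U phi Dphi regular _ r Hball) as [L [HL Hlip]].
  destruct (deriv_from_continuous _ _ _ _ Hdx0 (r / 2)) as [d [Hd Hc]]; [lra|].
  assert (Hne := norm_ge_0 e).
  set (K := 2 * (kappa * L * norm e) + 1).
  assert (HK0 : 0 <= kappa * L * norm e).
  { apply Rmult_le_pos; [|auto]. apply Rmult_le_pos; lra. }
  assert (HK : 1 <= K) by (unfold K; lra).
  exists (Rmin d (/ K)); split.
  { apply Rmin_pos; [auto|apply Rinv_0_lt_compat; lra]. }
  intros t2 Ht2 Ht2t1.
  assert (H1 := Rmin_l d (/ K)); assert (H2 := Rmin_r d (/ K)).
  assert (HKt : forall t, s0 <= t <= t2 -> K * (t - s0) <= 1).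
  { intros t Ht; rewrite <- (Rinv_r K) by lra; apply Rmult_le_compat_l; lra. }
  apply (closed_approx C); [apply (cone_closed (k := RealScalars) _ cone)|].
  intros eta Heta.
  assert (Hnorm : 0 < 2 * (norm e + 1)) by lra.
  (* With [g <= 2], this keeps [x + eps g e] in the ball of radius [r] and within
     [eta] of [x]. *)
  set (eps := Rmin eta (r / 2) / (2 * (norm e + 1))).
  assert (Hm0 : 0 < Rmin eta (r / 2)) by (apply Rmin_pos; lra).
  assert (Heps : 0 < eps) by now apply Rdiv_lt_0_compat.
  assert (Heps2 : eps * 2 * norm e <= Rmin eta (r / 2)).
  { apply Rle_trans with (eps * (2 * (norm e + 1))); [|unfold eps; apply Req_le; field; lra].
    rewrite Rmult_assoc; apply Rmult_le_compat_l; lra. }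
  assert (Hm1 := Rmin_l eta (r / 2)); assert (Hm2 := Rmin_r eta (r / 2)).
  set (g := fun t => 1 + K * (t - s0)).
  assert (Hg : forall t, s0 <= t <= t2 -> 1 <= g t <= 2).
  { intros t Ht; specialize (HKt t Ht). unfold g.
    assert (0 <= K * (t - s0)) by (apply Rmult_le_pos; lra). lra. }
  assert (Hge : forall t, s0 <= t <= t2 -> norm (scal (eps * g t) e) <= r / 2 /\
                 norm (scal (eps * g t) e) <= eta).
  { intros t Ht; specialize (Hg t Ht).
    assert (Hle : norm (scal (eps * g t) e) <= Rmin eta (r / 2)); [|lra].
    eapply Rle_trans; [apply norm_scal_le|].
    eapply Rle_trans; [|exact Heps2].
    rewrite Rabs_pos_eq by (apply Rmult_le_pos; lra).
    apply Rmult_le_compat_r; [auto|]. apply Rmult_le_compat_l; lra. }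
  assert (Hmain : forall t, s0 <= t <= t2 ->
            C (minus (plus (x t) (scal (eps * g t) e)) (y t))).
  { apply real_induction.
    - apply (cone_eq C (plus (minus (x s0) (y s0)) (scal eps e))).
      + apply (cone_add C cone); [auto|].
        apply (cone_scale C cone); [lra|apply interior_in_cone, e0_interior; exact cone].
      + unfold g; vec.
    - intros t Ht IH.
      destruct (Hxy t ltac:(lra)) as (_ & _ & _ & Hdx & Hdy & _).
      assert (Hde : deriv_from s0 (fun t => scal (eps * g t) e) t
                (plus (scal (eps * K) e) (scal (eps * g t) zero))).
      { apply (deriv_from_scal s0 (fun t => eps * g t) (eps * K) (fun _ => e)).
        - unfold g; auto_derive; [auto|ring].
        - apply deriv_from_const. }
      exact (cone_left_limit C cone s0 t
        (fun t => minus (plus (x t) (scal (eps * g t) e)) (y t)) _ (proj1 Ht)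
        (deriv_from_minus _ _ _ _ _ _ (deriv_from_plus _ _ _ _ _ _ Hdx Hde) Hdy) IH).
    - intros t Ht IH.
      destruct (Hxy t ltac:(lra)) as (HJ & _ & HUy & Hdx & Hdy & Hsub).
      destruct (Hge t ltac:(lra)) as [Hge1 _].
      specialize (Hg t ltac:(lra)).
      set (q := plus (x t) (scal (eps * g t) e)).
      assert (Hxt : norm (minus (x t) (x s0)) <= r / 2).
      { apply Hc; [lra|]. apply Rabs_def1; lra. }
      assert (Hqr : norm (minus q (x s0)) <= r).
      { replace r with (r / 2 + r / 2) by field.
        apply (norm_plus_le _ (x t - x s0)%V ((eps * g t) *: e)%V);
          [unfold q; vec|auto|auto]. }
      destruct (quasimonotone t (y t) q e HJ HUy (Hball q Hqr) IH e0_interior (eps / 2))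
        as [d1 [Hd1 Hqm]]; [lra|].
      assert (Hz : 0 < eps / (4 * kappa)) by (apply Rdiv_lt_0_compat; lra).
      destruct (Hdx _ Hz) as [d2 [Hd2 Hx2]].
      destruct (Hdy _ Hz) as [d3 [Hd3 Hy3]].
      exists (Rmin d1 (Rmin d2 d3)); split; [repeat apply Rmin_pos; auto|].
      intros t' Ht' Ht'2.
      assert (A1 := Rmin_l d1 (Rmin d2 d3)); assert (A2 := Rmin_r d1 (Rmin d2 d3)).
      assert (A3 := Rmin_l d2 d3); assert (A4 := Rmin_r d2 d3).
      set (h := t' - t).
      assert (Hh : 0 < h /\ h < d1 /\ h < d2 /\ h < d3) by (unfold h; lra).
      specialize (Hqm h ltac:(lra)).
      specialize (Hx2 t' ltac:(lra)); specialize (Hy3 t' ltac:(lra)).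
      fold h in Hx2, Hy3.
      rewrite Rabs_pos_eq in Hx2 by lra; rewrite Rabs_pos_eq in Hy3 by lra.
      specialize (Hx2 ltac:(lra)); specialize (Hy3 ltac:(lra)).
      assert (Hlipq : norm (minus (phi t (x t)) (phi t q)) <= L * (eps * g t * norm e)).
      { eapply Rle_trans; [apply Hlip; auto; lra|].
        apply Rmult_le_compat_l; [auto|].
        rewrite norm_minus_comm.
        apply (norm_le_eq _ (scal (eps * g t) e)); [unfold q; vec|].
        eapply Rle_trans; [apply norm_scal_le|].
        rewrite Rabs_pos_eq by (apply Rmult_le_pos; lra). apply Rle_refl. }
      assert (B1 := Hunit _ _ Hx2).
      assert (B2 := Hunit (opp (y t' - y t - h *: dy t)%V) (eps / (4 * kappa) * h)
                 ltac:(eapply Rle_trans; [|exact Hy3]; apply Req_le, vnorm_opp)).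
      assert (B3 := cone_scale C cone h _ ltac:(lra) (Hunit _ _ Hlipq)).
      assert (B4 := cone_scale C cone h _ ltac:(lra) Hsub).
      assert (B5 : C (scal (h * eps * (K - kappa * L * norm e * g t - 1)) e)).
      { apply (cone_scale C cone); [|apply interior_in_cone, e0_interior; exact cone].
        apply Rmult_le_pos; [apply Rmult_le_pos; lra|].
        assert (kappa * L * norm e * g t <= kappa * L * norm e * 2)
          by (apply Rmult_le_compat_l; lra).
        unfold K; lra. }
      eapply (cone_eq C).
      { apply (cone_add C cone); [exact Hqm|].
        apply (cone_add C cone); [exact B1|].
        apply (cone_add C cone); [exact B2|].
        apply (cone_add C cone); [exact B3|].
        apply (cone_add C cone); [exact B4|exact B5]. }
      replace t' with (t + h) by (unfold h; ring).
      unfold q, g; vec. }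
  exists (minus (plus (x t2) (scal (eps * g t2) e)) (y t2)); split.
  - apply (norm_le_eq _ (scal (eps * g t2) e)); [vec|apply Hge; lra].
  - apply Hmain; lra.
Qed.

(** Subsolutions stay below solutions: [comparison_local] carries the inequality
    beyond any time at which it holds. *)
Lemma comparison s0 t1 (x y dy : R -> X) :
  (forall t, s0 <= t <= t1 -> time_interval T t /\ U (x t) /\ U (y t) /\
     deriv_from s0 x t (phi t (x t)) /\ deriv_from s0 y t (dy t) /\
     C (minus (phi t (y t)) (dy t))) ->
  C (minus (x s0) (y s0)) ->
  forall t, s0 <= t <= t1 -> C (minus (x t) (y t)).
Proof.
  intros Hxy Hinit; apply real_induction; auto.
  - intros t Ht IH.
    destruct (Hxy t ltac:(lra)) as (_ & _ & _ & Hdx & Hdy & _).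
    exact (cone_left_limit C cone s0 t (fun t => minus (x t) (y t)) _ (proj1 Ht)
      (deriv_from_minus _ _ _ _ _ _ Hdx Hdy) IH).
  - intros t Ht IH.
    destruct (comparison_local t t1 x y dy) as [delta [Hdelta H]]; auto; [lra| |].
    + intros u Hu; destruct (Hxy u ltac:(lra)) as (A1 & A2 & A3 & A4 & A5 & A6).
      repeat split; auto; try apply A1;
        apply (deriv_from_weaken s0); auto; lra.
    + exists delta; split; auto; intros u Hu Hut1; apply H; lra.
Qed.

End OrderPreserving.

(** * The contraction rate *)

Section ContractionRate.

Context {X : CompleteNormedModule R_AbsRing}.
Implicit Types (p q u v w e : X).
Variable C : X -> Prop.
Hypothesis cone : closed_pointed_cone (k := RealScalars) (X := X) C.
Variable e0 : X.
Hypothesis e0_interior : cone_interior (k := RealScalars) (X := X) C e0.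
Variables (T : Rbar) (U : X -> Prop) (phi : R -> X -> X) (Dphi : R -> X -> X -> X).
Hypothesis U_open : open U.
Hypothesis U_interior : forall p, U p -> cone_interior (k := RealScalars) (X := X) C p.
Hypothesis U_star : forall (lambda : R) p, 0 < lambda <= 1 -> U p -> U (scal lambda p).
Hypothesis regular : regular_field (k := RealScalars) (X := X) T U phi Dphi.

Notation flow_of s p := (fun t => flow (k := RealScalars) (X := X) T U phi s t p).
Notation life s p := (life_time (k := RealScalars) (X := X) T U phi s p).
Notation contracts a := (thompson_contracts (k := RealScalars) (X := X) C T U phi U a).

Definition infinitesimal_rate (a : R) : Prop := forall s p, time_interval T s -> U p ->
  C (minus (scal (- a) p) (minus (Dphi s p p) (phi s p))).

(** The integrated form of [infinitesimal_rate] along the segment from [lambda p]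
    to [p]. *)
Definition radial_rate (a : R) : Prop := forall s p (lambda : R),
  time_interval T s -> U p -> 0 < lambda <= 1 ->
  C (plus (minus (scal (a * ln lambda) p) (phi s p))
          (scal (/ lambda) (phi s (scal lambda p)))).

Lemma field_deriv_along s p w (a t : R) : time_interval T s -> U (plus p (scal t w)) ->
  deriv_from a (fun r => phi s (plus p (scal r w))) t (Dphi s (plus p (scal t w)) w).
Proof.
  intros Hs Hp; apply (filterdiff_along (phi s)).
  now apply (field_differentiable (k := RealScalars) _ _ _ _ regular).
Qed.

Lemma Dphi_scal s p (a : R) w : time_interval T s -> U p ->
  Dphi s p (scal a w) = scal a (Dphi s p w).
Proof.
  intros Hs Hp.
  destruct (field_differentiable (k := RealScalars) _ _ _ _ regular s p Hs Hp) as [Hl _].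
  exact (linear_scal _ Hl a w).
Qed.

(** The function [nu -> - a ln nu p - phi (nu p) / nu] has derivative
    [(- a (nu p) - (Dphi (nu p) (nu p) - phi (nu p))) / nu^2]. *)
Lemma infinitesimal_radial a : infinitesimal_rate a -> radial_rate a.
Proof.
  intros H s p lambda Hs Hp Hl.
  set (g := fun nu => minus (scal (- a * ln nu) p) (scal (/ nu) (phi s (plus zero (scal nu p))))).
  set (dg := fun nu => minus
    (plus (scal (- a * / nu) p) (scal (- a * ln nu) zero))
    (plus (scal (- / nu ^ 2) (phi s (plus zero (scal nu p))))
       (scal (/ nu) (Dphi s (plus zero (scal nu p)) p)))).
  assert (Hz : forall nu : R, @eq X (plus zero (scal nu p)) (scal nu p)) by (intros; vec).
  assert (HC : C (minus (g 1) (g lambda))).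
  { apply (cone_mean_value C cone e0 lambda 1 g dg e0_interior); [lra| |].
    - intros nu Hnu; apply deriv_from_minus.
      + apply (deriv_from_scal lambda (fun nu => - a * ln nu) (- a * / nu) (fun _ => p)).
        * auto_derive; [lra|ring].
        * apply deriv_from_const.
      + (* Adding [zero] puts the ray in the form that [field_deriv_along] expects. *)
        apply (deriv_from_scal lambda Rinv (- / nu ^ 2)
          (fun nu => phi s (plus zero (scal nu p)))).
        * auto_derive; [lra|field; lra].
        * apply field_deriv_along; [auto|rewrite Hz; apply U_star; auto; lra].
    - intros nu Hnu; unfold dg; rewrite !Hz.
      assert (HU : U (scal nu p)) by (apply U_star; auto; lra).
      assert (HA := H s (scal nu p) Hs HU).
      rewrite (Dphi_scal s (scal nu p) nu p Hs HU) in HA.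
      apply (cone_eq C (scal (/ nu ^ 2) (minus (scal (- a) (scal nu p))
        (minus (scal nu (Dphi s (scal nu p) p)) (phi s (scal nu p)))))).
      + apply (cone_scale C cone); [|exact HA].
        apply Rlt_le, Rinv_0_lt_compat, pow_lt; lra.
      + vec. }
  apply (cone_eq C _ _ HC); unfold g; rewrite !Hz, ln_1.
  assert (H1 : @eq X (scal 1 p) p) by vec.
  rewrite H1; vec.
Qed.

(** Differentiation of [radial_rate] at [lambda = 1]. *)
Lemma radial_infinitesimal a :
  (forall s p (lambda : R), time_interval T s -> U p -> 0 < lambda < 1 ->
    C (plus (minus (scal (a * ln lambda) p) (phi s p))
          (scal (/ lambda) (phi s (scal lambda p))))) ->
  infinitesimal_rate a.
Proof.
  intros H s p Hs Hp.
  set (g := fun eta => plus (minus (scal (a * ln (1 - eta)) p) (phi s p))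
              (scal (/ (1 - eta)) (phi s (plus p (scal eta (opp p)))))).
  assert (Hz : forall eta : R, @eq X (plus p (scal eta (opp p))) (scal (1 - eta) p))
    by (intros; vec).
  assert (Hp0 : @eq X (plus p (scal 0 (opp p))) p) by vec.
  eapply (cone_derivative C cone 0 g _ 1).
  - eapply deriv_from_eq.
    + apply deriv_from_plus; [apply deriv_from_minus|].
      * apply (deriv_from_scal 0 (fun eta => a * ln (1 - eta)) (- a) (fun _ => p)).
        -- auto_derive; [lra|field].
        -- apply deriv_from_const.
      * apply deriv_from_const.
      * apply (deriv_from_scal 0 (fun eta => / (1 - eta)) 1
          (fun eta => phi s (plus p (scal eta (opp p))))).
        -- auto_derive; [lra|field].
        -- apply field_deriv_along; [auto|now rewrite Hp0].
    + cbv beta; rewrite Hp0.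
      replace (Dphi s p (opp p)) with (opp (Dphi s p p)).
      * vec_with ltac:(first [ring|field]).
      * replace (opp p) with (scal (-1) p) by vec.
        rewrite Dphi_scal by auto; vec.
  - unfold g; rewrite Hp0, Rminus_0_r, ln_1; vec.
  - lra.
  - intros h Hh; unfold g; rewrite Rplus_0_l, Hz.
    destruct (Req_dec h 0) as [->|Hne].
    + rewrite Rminus_0_r, ln_1.
      apply (cone_eq C zero); [apply (cone_zero (k := RealScalars) _ cone)|].
      assert (H1 : @eq X (scal 1 p) p) by vec.
      rewrite H1; vec.
    + apply H; auto; lra.
Qed.

(** [mu x2] with [mu = exp (- d exp (- a (t - s)))] is a subsolution: its
    derivative is [- a mu ln mu x2 + mu phi(x2)], and this is at most
    [phi (mu x2)] by [radial_rate]. *)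
Lemma radial_subsolution a s t d (x1 x2 : R -> X) :
  order_preserving (k := RealScalars) (X := X) C T U phi U ->
  radial_rate a -> 0 <= d -> s <= t ->
  (forall r, s <= r <= t -> time_interval T r /\ U (x1 r) /\ U (x2 r) /\
     deriv_from s x1 r (phi r (x1 r)) /\ deriv_from s x2 r (phi r (x2 r))) ->
  C (minus (scal (exp d) (x1 s)) (x2 s)) ->
  C (minus (scal (exp (exp (- a * (t - s)) * d)) (x1 t)) (x2 t)).
Proof.
  intros mono Hrad Hd Hst Hx Hinit.
  set (c := fun r => exp (- a * (r - s)) * d).
  assert (Hc : forall r, 0 <= c r).
  { intros r; apply Rmult_le_pos; [apply Rlt_le, exp_pos|auto]. }
  set (mu := fun r => exp (- c r)).
  assert (Hmu : forall r, 0 < mu r <= 1).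
  { intros r; split; [apply exp_pos|].
    rewrite <- exp_0; specialize (Hc r). unfold mu.
    destruct (Req_dec (c r) 0) as [->|Hne]; [rewrite Ropp_0; lra|].
    apply Rlt_le, exp_increasing; lra. }
  assert (Hcmp : C (minus (x1 t) (scal (mu t) (x2 t)))).
  { apply (comparison C cone e0 e0_interior T U phi Dphi U_open regular mono s t
      x1 (fun r => scal (mu r) (x2 r))
      (fun r => plus (scal (a * c r * mu r) (x2 r)) (scal (mu r) (phi r (x2 r)))));
      [|cbv beta|lra].
    - intros r Hr; destruct (Hx r Hr) as (HJ & H1 & H2 & D1 & D2).
      assert (H3 := Hrad r (x2 r) (mu r) HJ H2 (Hmu r)).
      split; [auto|]. split; [auto|]. split; [apply U_star; auto|]. split; [auto|]. split.
      + apply deriv_from_scal; [|auto].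
        unfold mu, c; auto_derive; [auto|unfold Rminus; ring].
      + assert (Hln : ln (mu r) = - c r) by apply ln_exp.
        rewrite Hln in H3.
        assert (Hr0 := Hmu r).
        apply (cone_eq C (scal (mu r) (plus (minus (scal (a * - c r) (x2 r)) (phi r (x2 r)))
          (scal (/ mu r) (phi r (scal (mu r) (x2 r))))))).
        * apply (cone_scale C cone); [lra|exact H3].
        * vec.
    - assert (Hs : mu s = exp (- d)).
      { unfold mu, c; f_equal; rewrite Rminus_diag, Rmult_0_r, exp_0; ring. }
      rewrite Hs, exp_Ropp.
      assert (He := exp_pos d).
      apply (cone_eq C (scal (/ exp d) (minus (scal (exp d) (x1 s)) (x2 s)))); [|vec].
      apply (cone_scale C cone); [apply Rlt_le, Rinv_0_lt_compat; lra|auto]. }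
  fold (c t).
  assert (He := exp_pos (c t)).
  assert (Hmut : mu t = / exp (c t)) by (unfold mu; apply exp_Ropp).
  apply (cone_eq C (scal (exp (c t)) (minus (x1 t) (scal (mu t) (x2 t))))).
  - apply (cone_scale C cone); [lra|auto].
  - rewrite Hmut; vec.
Qed.

Lemma radial_contracts a :
  order_preserving (k := RealScalars) (X := X) C T U phi U ->
  radial_rate a -> contracts a.
Proof.
  intros mono Hrad p1 p2 H1 H2 s t Hs Hst Ht.
  assert (E1 : Rbar_lt t (life s p1)).
  { apply exit_life; [auto|]. eapply Rbar_lt_le_trans; [exact Ht|apply Rbar_min_l]. }
  assert (E2 : Rbar_lt t (life s p2)).
  { apply exit_life; [auto|]. eapply Rbar_lt_le_trans; [exact Ht|apply Rbar_min_r]. }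
  destruct (flow_maximal T U phi Dphi U_open regular s p1 Hs H1) as [F1 _].
  destruct (flow_maximal T U phi Dphi U_open regular s p2 Hs H2) as [F2 _].
  assert (Hx : forall r, s <= r <= t -> time_interval T r /\ U (flow_of s p1 r) /\
     U (flow_of s p2 r) /\
     deriv_from s (flow_of s p1) r (phi r (flow_of s p1 r)) /\
     deriv_from s (flow_of s p2) r (phi r (flow_of s p2 r))).
  { intros r Hr.
    assert (Hr1 : Rbar_lt r (life s p1)) by (apply Rbar_le_lt_trans with t; simpl; auto; lra).
    assert (Hr2 : Rbar_lt r (life s p2)) by (apply Rbar_le_lt_trans with t; simpl; auto; lra).
    split; [apply (time_interval_between T s r (life s p1)); auto; [lra|apply F1]|].
    destruct F1 as (_ & _ & _ & F1); destruct F2 as (_ & _ & _ & F2).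
    destruct (F1 r (proj1 Hr) Hr1); destruct (F2 r (proj1 Hr) Hr2); auto. }
  destruct (thompson_dist_spec C cone p1 p2 (U_interior p1 H1) (U_interior p2 H2))
    as (Hd & I12 & I21).
  set (d := thompson_dist (k := RealScalars) C p1 p2) in *.
  assert (S1 : flow_of s p1 s = p1) by apply F1.
  assert (S2 : flow_of s p2 s = p2) by apply F2.
  destruct (Hx t ltac:(lra)) as (_ & Ut1 & Ut2 & _).
  apply (thompson_dist_le C cone).
  - apply interior_in_cone, U_interior; auto.
  - apply interior_in_cone, U_interior; auto.
  - apply Rmult_le_pos; [apply Rlt_le, exp_pos|auto].
  - apply (radial_subsolution a s t d (flow_of s p2) (flow_of s p1)); auto.
    + intros r Hr; destruct (Hx r Hr) as (A1 & A2 & A3 & A4 & A5); auto.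
    + now rewrite S1, S2.
  - apply (radial_subsolution a s t d (flow_of s p1) (flow_of s p2)); auto.
    now rewrite S1, S2.
Qed.

(** Contraction of the pair [p], [lambda p], at distance at most [- ln lambda],
    is differentiated at the starting time. *)
Lemma contracts_radial a s p lambda : contracts a ->
  time_interval T s -> U p -> 0 < lambda < 1 ->
  C (plus (minus (scal (a * ln lambda) p) (phi s p))
          (scal (/ lambda) (phi s (scal lambda p)))).
Proof.
  intros Hcontr Hs Hp Hl.
  set (q := scal lambda p).
  assert (Hq : U q) by (apply U_star; auto; lra).
  assert (Cp := interior_in_cone C p (U_interior p Hp)).
  assert (Cq := interior_in_cone C q (U_interior q Hq)).
  set (r := - ln lambda).
  assert (Hr : 0 < r) by (assert (H := ln_increasing lambda 1 (proj1 Hl) (proj2 Hl)); rewrite ln_1 in H;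
        unfold r; lra).
  assert (Her : exp r = / lambda).
  { unfold r; rewrite exp_Ropp, exp_ln by lra; reflexivity. }
  assert (Hdist : thompson_dist (k := RealScalars) (X := X) C p q <= r).
  { apply (thompson_dist_le C cone); auto; [lra| |]; rewrite Her.
    - apply (cone_eq C zero); [apply (cone_zero (k := RealScalars) _ cone)|].
      unfold q; vec.
    - apply (cone_eq C (scal (/ lambda - lambda) p)); [|unfold q; vec].
      apply (cone_scale C cone); [|auto].
      assert (1 <= / lambda) by (rewrite <- Rinv_1; apply Rinv_le_contravar; lra).
      lra. }
  destruct (flow_maximal T U phi Dphi U_open regular s p Hs Hp) as [Fp _].
  destruct (flow_maximal T U phi Dphi U_open regular s q Hs Hq) as [Fq _].
  destruct (flow_expansion T U phi Dphi U_open regular s p Hs Hp 1 Rlt_0_1) as [d [Hd Ep]].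
  destruct (flow_expansion T U phi Dphi U_open regular s q Hs Hq 1 Rlt_0_1) as [d' [Hd' Eq]].
  destruct Fp as (Lp & _ & Sp & Dp); destruct Fq as (Lq & _ & Sq & Dq).
  destruct (Dp s (Rle_refl s) Lp) as [_ Dps].
  destruct (Dq s (Rle_refl s) Lq) as [_ Dqs].
  cbv beta in Sp, Sq; rewrite Sp in Dps; rewrite Sq in Dqs.
  set (k := fun t => exp (exp (- a * (t - s)) * r)).
  assert (Hks : k s = / lambda).
  { unfold k; rewrite Rminus_diag, Rmult_0_r, exp_0, Rmult_1_l; exact Her. }
  apply (cone_derivative C cone s (fun t => minus (scal (k t) (flow_of s q t)) (flow_of s p t))
    _ (Rmin d d')).
  - eapply deriv_from_eq.
    + apply deriv_from_minus; [|exact Dps].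
      apply deriv_from_scal; [|exact Dqs].
      assert (Hdk : is_derive k s (- a * r * / lambda)); [|exact Hdk].
      rewrite <- Hks; unfold k; auto_derive; [auto|].
      unfold Rminus; rewrite Rplus_opp_r, Rmult_0_r, exp_0; ring.
    + cbv beta; rewrite Sq, Hks; unfold q, r; vec.
  - cbv beta; rewrite Sp, Sq, Hks; unfold q; vec.
  - now apply Rmin_pos.
  - intros h Hh.
    assert (A1 := Rmin_l d d'); assert (A2 := Rmin_r d d').
    destruct (Ep h ltac:(lra)) as [Xp _]; destruct (Eq h ltac:(lra)) as [Xq _].
    assert (Lp' := exit_life T U phi s p (s + h) ltac:(lra) Xp).
    assert (Lq' := exit_life T U phi s q (s + h) ltac:(lra) Xq).
    assert (Hc : thompson_dist (k := RealScalars) (X := X) C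
        (flow_of s p (s + h)) (flow_of s q (s + h)) <= exp (- a * (s + h - s)) * r).
    { eapply Rle_trans; [apply Hcontr; auto; [lra|apply Rbar_min_case; auto]|].
      apply Rmult_le_compat_l; [apply Rlt_le, exp_pos|exact Hdist]. }
    destruct (Dp (s + h) ltac:(lra) Lp') as [Up _].
    destruct (Dq (s + h) ltac:(lra) Lq') as [Uq _].
    destruct (thompson_dist_spec C cone _ _ (U_interior _ Up) (U_interior _ Uq))
      as (_ & I & _).
    cbv beta in I, Hc.
    match type of Hc with ?d <= _ => set (D := d) in * end.
    apply (cone_eq C (plus (minus (scal (exp D) (flow_of s q (s + h))) (flow_of s p (s + h)))
      (scal (k (s + h) - exp D) (flow_of s q (s + h))))); [|vec].
    apply (cone_add C cone); [exact I|].
    apply (cone_scale C cone); [|apply interior_in_cone, U_interior; exact Uq].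
    unfold k; destruct Hc as [Hlt| ->]; [|lra].
    assert (H := exp_increasing _ _ Hlt); lra.
Qed.

Lemma contracts_iff_rate a :
  order_preserving (k := RealScalars) (X := X) C T U phi U ->
  contracts a <-> infinitesimal_rate a.
Proof.
  intros mono; split; intros H.
  - apply radial_infinitesimal; intros s p lambda Hs Hp Hl; now apply contracts_radial.
  - now apply radial_contracts, infinitesimal_radial.
Qed.

End ContractionRate.

(** By [thompson_M_le] a number [- a] is an upper bound of the supremum exactly when
    [a] is an infinitesimal rate, so the admissible constants are those below minus
    the supremum; this covers the infinite values as well. *)
Lemma best_constant_real_scalars
  (X : CompleteNormedModule R_AbsRing)
  (C : X -> Prop) (hC : closed_pointed_cone (k := RealScalars) (X := X) C)
  (hC0 : exists x : X, cone_interior (k := RealScalars) (X := X) C x)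
  (T : Rbar)
  (U : X -> Prop) (hUopen : open U)
  (hUC : forall x : X, U x -> cone_interior (k := RealScalars) (X := X) C x)
  (hUscal : forall (lambda : R) (x : X), 0 < lambda <= 1 -> U x -> U (scal lambda x))
  (phi : R -> X -> X) (Dphi : R -> X -> X -> X)
  (hphi : regular_field (k := RealScalars) (X := X) T U phi Dphi)
  (hmono : order_preserving (k := RealScalars) (X := X) C T U phi U) :
  is_best_constant (thompson_contracts (k := RealScalars) (X := X) C T U phi U)
    (Rbar_opp (Rbar_lub (fun m => exists (s : R) (x : X), time_interval T s /\ U x /\
       m = thompson_M (k := RealScalars) (X := X) C (minus (Dphi s x x) (phi s x)) x))).
Proof.
  destruct hC0 as [e0 He0].
  assert (Hiff := fun a => contracts_iff_rate C hC e0 He0 T U phi Dphi hUopen hUC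
                             hUscal hphi a hmono).
  unfold Rbar_lub.
  match goal with |- context [Rbar_ex_lub ?E] => destruct (Rbar_ex_lub E) as [S HS] end.
  simpl proj1_sig; destruct HS as [Hub Hlub].
  assert (Hrate : forall a, infinitesimal_rate C T U phi Dphi a <-> Rbar_le S (- a)).
  { intros a; split.
    - intros Ha; apply Hlub; intros m (s & x & Hs & Hx & ->).
      apply (thompson_M_le C hC); [|now apply Ha].
      apply interior_in_cone, hUC, Hx.
    - intros HS s x Hs Hx.
      apply (thompson_M_le C hC); [apply interior_in_cone, hUC, Hx|].
      apply Rbar_le_trans with (2 := HS), Hub; now exists s, x. }
  assert (H : forall a, thompson_contracts (k := RealScalars) (X := X) C T U phi U a
                <-> Rbar_le S (- a)).
  { intros a; rewrite Hiff; apply Hrate. }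
  destruct S as [S| |]; simpl.
  - split; [apply H; simpl; lra|].
    intros b Hb; apply H in Hb; simpl in Hb; lra.
  - intros b Hb; now apply H in Hb.
  - intros b; apply H; exact I.
Qed.

(** * Restriction of scalars *)

Section RestrictScalars.

Variable X : CompleteNormedModule C_AbsRing.

Definition real_scal (a : R) (x : X) : X := scal (RtoC a) x.

Lemma real_scal_assoc (a b : R) (x : X) : real_scal a (real_scal b x) = real_scal (a * b) x.
Proof. unfold real_scal; rewrite RtoC_mult; exact (scal_assoc (RtoC a) (RtoC b) x). Qed.

Lemma real_scal_one (x : X) : real_scal 1 x = x.
Proof. exact (scal_one x). Qed.

Lemma real_scal_distr_l (a : R) (x y : X) :
  real_scal a (plus x y) = plus (real_scal a x) (real_scal a y).
Proof. exact (scal_distr_l (RtoC a) x y). Qed.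

Lemma real_scal_distr_r (a b : R) (x : X) :
  real_scal (a + b) x = plus (real_scal a x) (real_scal b x).
Proof. unfold real_scal; rewrite RtoC_plus; exact (scal_distr_r (RtoC a) (RtoC b) x). Qed.

Lemma norm_real_scal (a : R) (x : X) : norm (real_scal a x) <= Rabs a * norm x.
Proof. rewrite <- Cmod_R; exact (norm_scal (RtoC a) x). Qed.

Definition restrict_module : ModuleSpace.class_of R_AbsRing X :=
  ModuleSpace.Class R_AbsRing X
    (AbelianGroup.class X)
    (ModuleSpace.Mixin R_AbsRing X real_scal real_scal_assoc real_scal_one
       real_scal_distr_l real_scal_distr_r).

Definition restrict_aux : NormedModuleAux.class_of R_AbsRing X :=
  NormedModuleAux.Class R_AbsRing X restrict_module (UniformSpace.class X).

Definition restrict_normed : NormedModule.class_of R_AbsRing X :=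
  NormedModule.Class R_AbsRing X restrict_aux
    (NormedModule.Mixin R_AbsRing (NormedModuleAux.Pack R_AbsRing X restrict_aux X)
      (fun x : X => norm x) (@norm_factor C_AbsRing X)
      (fun x y => norm_triangle (K := C_AbsRing) (V := X) x y) norm_real_scal
      (fun x y eps => norm_compat1 (K := C_AbsRing) (V := X) x y eps)
      (fun x y eps => norm_compat2 (K := C_AbsRing) (V := X) x y eps)
      (fun x => norm_eq_zero (K := C_AbsRing) (V := X) x)).

(** Cones, solutions and flows involve only real multiples of vectors, so they are
    the same over [X] and over [restrict_scalars X] by computation.  The derivative
    of the field is linear over the complex numbers, which [filterdiff_restrict]
    weakens to the real numbers. *)
Definition restrict_scalars : CompleteNormedModule R_AbsRing :=
  CompleteNormedModule.Pack R_AbsRing X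
    (CompleteNormedModule.Class R_AbsRing X restrict_normed
       (CompleteNormedModule.mixin C_AbsRing X (CompleteNormedModule.class C_AbsRing X)))
    X.

Lemma filterdiff_restrict (f l : X -> X) (F : (X -> Prop) -> Prop) :
  filterdiff f F l ->
  filterdiff (K := R_AbsRing) (U := restrict_scalars) (V := restrict_scalars) f F l.
Proof.
  intros [[Hp Hs Hn] Hd]; split; [split|exact Hd].
  - exact Hp.
  - intros a x; exact (Hs (RtoC a) x).
  - exact Hn.
Qed.

End RestrictScalars.

Theorem theorem1p1
  (k : scalar_kind) (X : CompleteNormedModule (scalar_field k))
  (C : X -> Prop) (hC : closed_pointed_cone C) (hC0 : exists x : X, cone_interior C x)
  (T : Rbar) (hT : Rbar_lt 0 T)
  (U : X -> Prop) (hUopen : open U) (hUC : forall x : X, U x -> cone_interior C x)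
  (hUscal : forall (lambda : R) (x : X), 0 < lambda <= 1 -> U x -> U (rscal lambda x))
  (phi : R -> X -> X) (Dphi : R -> X -> X -> X)
  (hphi : regular_field T U phi Dphi)
  (hmono : order_preserving C T U phi U) :
  is_best_constant (thompson_contracts C T U phi U)
    (Rbar_opp (Rbar_lub (fun m => exists (s : R) (x : X), time_interval T s /\ U x /\
       m = thompson_M C (minus (Dphi s x x) (phi s x)) x))).
Proof.
  destruct k.
  - exact (best_constant_real_scalars X C hC hC0 T U hUopen hUC hUscal phi Dphi hphi hmono).
  - assert (hCr : closed_pointed_cone (k := RealScalars) (X := restrict_scalars X) C).
    { destruct hC; now split. }
    assert (hphir : regular_field (k := RealScalars) (X := restrict_scalars X) T U phi Dphi).
    { destruct hphi as [h1 h2 h3]; split; [exact h1| |exact h3].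
      intros t x Ht Hx; apply filterdiff_restrict, h2; auto. }
    exact (best_constant_real_scalars (restrict_scalars X) C hCr hC0 T U hUopen hUC hUscal phi Dphi
             hphir hmono).
Qed.
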